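(* Let $H$ be a Krull monoid and $\varphi\colon H\to\mathcal F(P)$ a cofinal divisor homomorphism into a free monoid such that the class group $G=\mathcal C(\varphi)$ is an infinite cyclic group, which we identify with $\mathbb Z$. Let $G_P\subset G$ denote the set of classes containing prime divisors. The following statements are equivalent: (a) $G_P^+$ or $G_P^-$ is finite. (b) $H$ is locally tame, i.e., $\mathsf t(H,u)<\infty$ for all $u\in\mathcal A(H_{\mathrm{red}})$. (c) The catenary degree $\mathsf c(H)$ is finite. (d) The set of distances $\Delta(H)$ is finite. (e) The elasticity $\rho(H)$ is a rational number. (f) $\rho_2(H)$ is finite. (g) There exists some $M\in\mathbb N$ such that, for each $k\in\mathbb N$, we have $\rho_{k+1}(H)-\rho_k(H)\le M$. (h) There exists some $M\in\mathbb N$ such that, for each $k\in\mathbb N$, the set $\mathcal V_k(H)$ is an almost arithmetical progression (AAP) with difference $\min\Delta(H)$ and bound $M$.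
   Context: $\mathbb N$ is the set of positive integers, $\mathbb N_0=\mathbb N\cup\{0\}$, and $[a,b]=\{x\in\mathbb Z: a\le x\le b\}$. A monoid is a commutative cancellative semigroup with unit element. For a monoid $H$: $H^\times$ is its group of units, $H_{\mathrm{red}}=\{aH^\times: a\in H\}$, $\mathsf q(H)$ its quotient group, $\mathcal A(H)$ its set of atoms (irreducible elements). $\mathcal F(P)$ is the free abelian monoid with basis $P$, and $|a|=\sum_p\mathsf v_p(a)$ is the length of $a=\prod_p p^{\mathsf v_p(a)}\in\mathcal F(P)$. Krull monoids. A monoid homomorphism $\varphi\colon H\to D$ is a divisor homomorphism if $\varphi(a)\mid\varphi(b)$ implies $a\mid b$; it is cofinal if for every $a\in D$ there is $u\in H$ with $a\mid\varphi(u)$. $H$ is a Krull monoid if there is a divisor homomorphism from $H$ into a free abelian monoid (equivalently, $H_{\mathrm{red}}$ is a saturated submonoid of a free monoid, i.e. the inclusion is a divisor homomorphism). The class group is $\mathcal C(\varphi)=\mathsf q(D)/\mathsf q(\varphi(H))$, written additively, with $[a]=a\,\mathsf q(\varphi(H))$. For $D=\mathcal F(P)$, $G_P=\{[p]: p\in P\}$ is the set of classes containing prime divisors. When $\mathcal C(\varphi)=\mathbb Z$, $G_P^+=G_P\cap\mathbb N$ and $G_P^-=G_P\cap(-\mathbb N)$. Factorizations. $\mathsf Z(H)=\mathcal F(\mathcal A(H_{\mathrm{red}}))$, $\pi\colon\mathsf Z(H)\to H_{\mathrm{red}}$ is the homomorphism with $\pi(u)=u$ for atoms $u$; for $a\in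 H$, $\mathsf Z(a)=\pi^{-1}(aH^\times)$ and $\mathsf L(a)=\{|z|: z\in\mathsf Z(a)\}$. $H$ is atomic if all $\mathsf Z(a)\ne\emptyset$ (Krull monoids are atomic). For $z,z'\in\mathsf Z(H)$, $\mathsf d(z,z')=\max\{|z\gcd(z,z')^{-1}|,|z'\gcd(z,z')^{-1}|\}$. Invariants. For $\emptyset\ne L\subset\mathbb N$, $\rho(L)=\sup L/\min L$, and $\rho(\{0\})=1$; $\rho(H)=\sup\{\rho(\mathsf L(b)): b\in H\}\in\mathbb R_{\ge1}\cup\{\infty\}$. For $k\in\mathbb N$ (and $H\neq H^\times$, which holds here), $\mathcal V_k(H)=\bigcup_{a\in H,\,k\in\mathsf L(a)}\mathsf L(a)$ and $\rho_k(H)=\sup\mathcal V_k(H)$. Distinct $k,l\in L\subset\mathbb Z$ are adjacent if $L\cap[\min\{k,l\},\max\{k,l\}]=\{k,l\}$; $\Delta(L)$ is the set of all $|k-l|$ with $k,l\in L$ adjacent, and $\Delta(H)=\bigcup_{b\in H}\Delta(\mathsf L(b))$. The catenary degree $\mathsf c(a)$ is the smallest $N\in\mathbb N_0\cup\{\infty\}$ such that for any $z,z'\in\mathsf Z(a)$ there are $z=z_0,z_1,\dots,z_k=z'$ in $\mathsf Z(a)$ with $\mathsf d(z_{i-1},z_i)\le N$ for all $i\in[1,k]$; $\mathsf c(H)=\sup_{a\in H}\mathsf c(a)$. For $a\in H$ and $x\in\mathsf Z(H)$, $\mathsf t(a,x)$ is the smallest $N\in\mathbb N_0\cup\{\infty\}$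 such that: if $\mathsf Z(a)\cap x\mathsf Z(H)\ne\emptyset$ and $z\in\mathsf Z(a)$, then there is $z'\in\mathsf Z(a)\cap x\mathsf Z(H)$ with $\mathsf d(z,z')\le N$. $\mathsf t(H,u)=\sup_{a\in H}\mathsf t(a,u)$. A set $L\subset\mathbb Z$ is an AAP with difference $d\in\mathbb N$ and bound $M\in\mathbb N_0$ if $L=y+(L'\cup L^*\cup L'')\subset y+d\mathbb Z$ with $y\in\mathbb Z$, $L^*$ finite and nonempty, $\min L^*=0$, $L^*=d\mathbb Z\cap[0,\max L^*]$, $L'\subset[-M,-1]$, $L''\subset\max L^*+[1,M]$. Convention for (h): if $\Delta(H)=\emptyset$ (so that $\mathcal V_k(H)=\{k\}$ for all $k$), condition (h) is regarded as satisfied. *)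

(* Defs.v *)
From HB Require Import structures.
From mathcomp Require Import all_boot all_order all_algebra finmap multiset.
From mathcomp Require Import generic_quotient ring_quotient.
From mathcomp Require Import boolp classical_sets cardinality reals ereal.

Set Implicit Arguments.
Unset Strict Implicit.
Unset Printing Implicit Defensive.

Import Order.TTheory GRing.Theory Num.Theory.

Local Open Scope mset_scope.
Local Open Scope classical_set_scope.
Local Open Scope quotient_scope.
Local Open Scope ring_scope.

(* Commutative cancellative monoids are written additively, so that they extend
   the nmodType of the algebraic hierarchy: the unit element is 0, the product
   ab is a + b, and "a divides b" reads "b = a + c for some c". *)
HB.mixin Record isCancellative M of GRing.Nmodule M := {
  cmon_addrI : forall a : M, injective (+%R a)
}.

#[short(type="cmonoidType")]
HB.structure Definition CMonoid := {M of isCancellative M & GRing.Nmodule M}.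

Section MonoidNotions.
Variable M : cmonoidType.
Implicit Types a b c u : M.

Definition divides a b := exists c, b = a + c.

Definition is_unit a := exists b, a + b = 0.

Definition is_atom u :=
  ~ is_unit u /\ forall a b, u = a + b -> is_unit a \/ is_unit b.

End MonoidNotions.

(* The free abelian monoid with basis P is {mset P}: a multiset x is the product
   of the p ^ (x p), `+` is the product, `&` the gcd, and size the length. *)
Section FreeMonoid.
Variable P : choiceType.
Local Open Scope mset_scope.

HB.instance Definition _ := Choice.on {mset P}.
HB.instance Definition _ := GRing.isNmodule.Build {mset P}
  (@msetDA P) (@msetDC P) (@mset0D P).

Lemma mset_addrI (A : {mset P}) : injective (+%R A).
Proof. by move=> B C eqBC; rewrite -[B](msetDKB A) -[C](msetDKB A); congr msetB. Qed.

HB.instance Definition _ := isCancellative.Build {mset P} mset_addrI.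

Definition fm_dist (z z' : {mset P}) : nat :=
  maxn (size (z `\` (z `&` z'))) (size (z' `\` (z `&` z'))).

End FreeMonoid.

Section Reduced.
Variable M : cmonoidType.
Implicit Types a b c u : M.

Definition assoc : rel M := fun a b => `[< exists2 u, is_unit u & b = a + u >].

Lemma is_unit0 : is_unit (0 : M).
Proof. by exists 0; rewrite addr0. Qed.

Lemma is_unitD u v : is_unit u -> is_unit v -> is_unit (u + v).
Proof. by move=> [x ux] [y vy]; exists (x + y); rewrite addrACA ux vy addr0. Qed.

Lemma assoc_refl : reflexive assoc.
Proof. by move=> a; apply/asboolP; exists 0; rewrite ?addr0 //; apply: is_unit0. Qed.

Lemma assoc_imp a b : assoc a b -> assoc b a.
Proof.
move=> /asboolP[u [v uv] ->]; apply/asboolP; exists v; first by exists u; rewrite addrC.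
by rewrite -addrA uv addr0.
Qed.

Lemma assoc_sym : symmetric assoc.
Proof. by move=> a b; apply/idP/idP; apply: assoc_imp. Qed.

Lemma assoc_trans : transitive assoc.
Proof.
move=> b a c /asboolP[u uU ->] /asboolP[v vU ->]; apply/asboolP.
by exists (u + v); [apply: is_unitD | rewrite addrA].
Qed.

Lemma assocD a b c d : assoc a b -> assoc c d -> assoc (a + c) (b + d).
Proof.
move=> /asboolP[u uU ->] /asboolP[v vU ->]; apply/asboolP.
by exists (u + v); [apply: is_unitD | rewrite addrACA].
Qed.

Canonical assoc_equiv := EquivRel assoc assoc_refl assoc_sym assoc_trans.
Canonical assoc_encModRel := defaultEncModRel assoc.

(* The associated reduced monoid, whose elements are the cosets of the units. *)
Definition reduced := {eq_quot assoc}.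

HB.instance Definition _ : EqQuotient M assoc reduced := EqQuotient.on reduced.
HB.instance Definition _ := Choice.on reduced.

Definition red_zero : reduced := lift_cst reduced 0.
Definition red_add := lift_op2 reduced +%R.

Lemma assoc_repr (a : M) : assoc a (repr (\pi_reduced a)).
Proof. by rewrite -eqmodE reprK. Qed.

Lemma pi_red_add : {morph \pi_reduced : x y / x + y >-> red_add x y}.
Proof.
move=> x y; unlock red_add; apply/eqmodP; apply: assocD; apply: assoc_repr.
Qed.
Canonical pi_red_zero_morph := PiConst red_zero.
Canonical pi_red_add_morph := PiMorph2 pi_red_add.

Lemma red_addA : associative red_add.
Proof. by move=> x y z; rewrite -[x]reprK -[y]reprK -[z]reprK !piE addrA. Qed.

Lemma red_addC : commutative red_add.
Proof. by move=> x y; rewrite -[x]reprK -[y]reprK !piE addrC. Qed.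

Lemma red_add0 : left_id red_zero red_add.
Proof. by move=> x; rewrite -[x]reprK !piE add0r. Qed.

HB.instance Definition _ :=
  GRing.isNmodule.Build reduced red_addA red_addC red_add0.

Lemma red_addrI (x : reduced) : injective (+%R x).
Proof.
change (injective (red_add x)) => y z.
rewrite -[x]reprK -[y]reprK -[z]reprK !piE => /eqmodP/asboolP[u uU].
rewrite -addrA => /cmon_addrI yz.
by apply/eqmodP/asboolP; exists u.
Qed.

HB.instance Definition _ := isCancellative.Build reduced red_addrI.

End Reduced.

Section QuotientGroup.
Variable M : cmonoidType.

(* Formal differences: (a, b) represents a - b. *)
Definition qeq : rel (M * M) := fun x y => x.1 + y.2 == y.1 + x.2.

Lemma qeq_refl : reflexive qeq.
Proof. by move=> x; apply/eqP. Qed.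

Lemma qeq_sym : symmetric qeq.
Proof. by move=> x y; rewrite /qeq eq_sym. Qed.

Lemma qeq_trans : transitive qeq.
Proof.
move=> y x z /eqP xy /eqP yz; apply/eqP; apply: (@cmon_addrI _ y.2).
by rewrite addrCA addrA [_ + z.2]addrC [x.1 + _]addrC (addrC y.2 x.1) xy
  addrA (addrC z.2) yz -addrA addrCA.
Qed.

Canonical qeq_equiv := EquivRel qeq qeq_refl qeq_sym qeq_trans.
Canonical qeq_encModRel := defaultEncModRel qeq.

Definition quotient_group := {eq_quot qeq}.

HB.instance Definition _ : EqQuotient (M * M)%type qeq quotient_group :=
  EqQuotient.on quotient_group.
HB.instance Definition _ := Choice.on quotient_group.

Definition prezero : M * M := (0, 0).
Definition preadd (x y : M * M) : M * M := (x.1 + y.1, x.2 + y.2).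
Definition preopp (x : M * M) : M * M := (x.2, x.1).

Definition q_zero : quotient_group := lift_cst quotient_group prezero.
Definition q_add := lift_op2 quotient_group preadd.
Definition q_opp := lift_op1 quotient_group preopp.

Lemma qeq_repr (x : M * M) : qeq x (repr (\pi_quotient_group x)).
Proof. by rewrite -eqmodE reprK. Qed.

Lemma pi_q_add : {morph \pi_quotient_group : x y / preadd x y >-> q_add x y}.
Proof.
move=> x y; unlock q_add; apply/eqmodP; rewrite /preadd /=; apply/eqP => /=.
by rewrite addrACA (eqP (qeq_repr x)) (eqP (qeq_repr y)) addrACA.
Qed.

Lemma pi_q_opp : {morph \pi_quotient_group : x / preopp x >-> q_opp x}.
Proof.
move=> x; unlock q_opp; apply/eqmodP; apply/eqP => /=.
by rewrite addrC -(eqP (qeq_repr x)) addrC.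
Qed.

Canonical pi_q_zero_morph := PiConst q_zero.
Canonical pi_q_add_morph := PiMorph2 pi_q_add.
Canonical pi_q_opp_morph := PiMorph1 pi_q_opp.

Lemma q_addA : associative q_add.
Proof.
move=> x y z; rewrite -[x]reprK -[y]reprK -[z]reprK !piE.
by rewrite /preadd /= !addrA.
Qed.

Lemma q_addC : commutative q_add.
Proof.
move=> x y; rewrite -[x]reprK -[y]reprK !piE.
by rewrite /preadd [_.1 + _]addrC [_.2 + _]addrC.
Qed.

Lemma q_add0 : left_id q_zero q_add.
Proof.
by move=> x; rewrite -[x]reprK !piE; case: (repr x) => a b; rewrite /preadd /= !add0r.
Qed.

Lemma q_addN : left_inverse q_zero q_opp q_add.
Proof.
move=> x; rewrite -[x]reprK !piE; apply/eqmodP/eqP => /=.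
by rewrite addr0 add0r addrC.
Qed.

HB.instance Definition _ :=
  GRing.isZmodule.Build quotient_group q_addA q_addC q_add0 q_addN.

Definition q_inj (a : M) : quotient_group := \pi_quotient_group (a, 0).

Lemma q_injD : {morph q_inj : a b / a + b}.
Proof.
move=> a b; change (q_inj (a + b) = q_add (q_inj a) (q_inj b)).
by rewrite /q_inj !piE /preadd /= addr0.
Qed.

End QuotientGroup.

Section DivisorTheory.
Variables (H D : cmonoidType) (phi : {additive H -> D}).

Definition divisor_hom := forall a b : H, divides (phi a) (phi b) -> divides a b.

Definition cofinal_hom := forall a : D, exists u : H, divides a (phi u).

(* The subgroup of q(D) which is the quotient group of phi(H). *)
Definition q_image : {pred quotient_group D} :=
  fun x => `[< exists a b : H, x = q_inj (phi a) - q_inj (phi b) >].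

Lemma q_image_zmod_closed : zmod_closed q_image.
Proof.
split; first by apply/asboolP; exists 0, 0; rewrite subrr.
move=> _ _ /asboolP[a [b ->]] /asboolP[c [d ->]]; apply/asboolP.
exists (a + d), (b + c); rewrite !(raddfD phi) !q_injD opprB opprD.
by rewrite addrACA.
Qed.

HB.instance Definition _ :=
  GRing.isZmodClosed.Build (quotient_group D) q_image q_image_zmod_closed.

Definition class_group : zmodType := Quotient.quot q_image.

Definition divisor_class (a : D) : class_group := \pi_(Quotient.quot q_image) (q_inj a).

End DivisorTheory.

Definition is_krull (H : cmonoidType) :=
  exists (P : choiceType) (phi : {additive H -> {mset P}}), divisor_hom phi.

Definition prime_classes (H : cmonoidType) (P : choiceType)
    (phi : {additive H -> {mset P}}) : set (class_group phi) :=
  [set divisor_class phi [mset p]%mset | p in [set: P]].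
Arguments prime_classes {H P} phi _.

Definition min_nat (L : set nat) : nat := xget 0%N [set m | L m /\ lbound L m].

Definition adjacent (L : set nat) (k l : nat) :=
  [/\ L k, L l, k <> l &
      L `&` [set x | (minn k l <= x <= maxn k l)%N] = [set k; l]].

Definition distances (L : set nat) : set nat :=
  [set d | exists k l, adjacent L k l /\ d = `|k%:Z - l%:Z|%N].

Definition is_AAP (d M : nat) (L : set int) :=
  (0 < d)%N /\ exists (y m : int) (L1 L0 L2 : set int),
    [/\ L = [set y + x | x in L1 `|` L0 `|` L2],
        L `<=` [set y + d%:Z * x | x in [set: int]],
        finite_set L0 &
      [/\ L0 0 /\ lbound L0 0, L0 m /\ ubound L0 m,
          L0 = [set d%:Z * x | x in [set: int]] `&` [set x | 0 <= x <= m],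
          L1 `<=` [set x | - M%:Z <= x <= -1] &
          L2 `<=` [set x | m + 1 <= x <= m + M%:Z]]].

Section Factorizations.
Variable H : cmonoidType.

Definition red_atom : choiceType := {u : reduced H | `[< is_atom u >]}.

Local Notation factorization := {mset red_atom}.

Definition pi_fact (z : factorization) : reduced H := \sum_(u <- z) val u.

Definition Zset (a : H) : set factorization :=
  [set z | pi_fact z = \pi_(reduced H) a].

Definition Lset (a : H) : set nat := [set size z | z in Zset a].

Definition V_ (k : nat) : set nat := \bigcup_(a in [set a | Lset a k]) Lset a.

Definition Delta : set nat := \bigcup_(a in [set: H]) distances (Lset a).

Definition chain_bound (a : H) (N : nat) :=
  forall z z', Zset a z -> Zset a z' ->
    exists s : seq factorization,
      [/\ {in s, forall y, Zset a y},
          path (fun x y => (fm_dist x y <= N)%N) z s & last z s = z'].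

Definition tame_bound (a : H) (x : factorization) (N : nat) :=
  Zset a `&` [set z | divides x z] !=set0 ->
  forall z, Zset a z ->
    exists2 z', (Zset a `&` [set y | divides x y]) z' & (fm_dist z z' <= N)%N.

End Factorizations.

(* Suprema and minima of sets of natural numbers that may be infinite are taken
   in the extended reals; the infimum of the empty set is +oo. *)
Section Invariants.
Variables (R : realType) (H : cmonoidType).
Local Open Scope ereal_scope.

Definition sup_nat (A : set nat) : \bar R := ereal_sup [set n%:R%:E | n in A].

Definition inf_nat (A : set nat) : \bar R := ereal_inf [set n%:R%:E | n in A].

Definition set_elasticity (L : set nat) : \bar R :=
  if `[< L = [set 0%N] >] then 1 else sup_nat L * ((min_nat L)%:R^-1)%:E.

Definition elasticity : \bar R :=
  ereal_sup [set set_elasticity (Lset b) | b in [set: H]].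

Definition rho_ (k : nat) : \bar R := sup_nat (V_ H k).

Definition catenary_degree : \bar R :=
  ereal_sup [set inf_nat (chain_bound a) | a in [set: H]].

Definition tame_degree (u : red_atom H) : \bar R :=
  ereal_sup [set inf_nat (tame_bound a [mset u]%mset) | a in [set: H]].

End Invariants.

(* Main.v *)
Require Import Defs.
From HB Require Import structures.
From mathcomp Require Import all_boot all_order all_algebra finmap multiset.
From mathcomp Require Import generic_quotient ring_quotient.
From mathcomp Require Import boolp classical_sets cardinality reals ereal.
From mathcomp Require Import zify ring.

(* Identify the reduced monoid with the multisets of primes whose classes sum to 0;
   its atoms are the minimal zero-sum multisets.

   Suppose the negative classes are bounded below by -m. By Lambert's argument on
   partial sums an atom has at most m nonnegative primes, so the number of
   nonnegative primes measures lengths up to the factor m. This makes the sets of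
   lengths of an element comparable and bounds the tame degree of an atom in terms
   of its size and the catenary degree in terms of m. For the elasticity, replace
   every nonnegative prime of an atom by one of finitely many representatives modulo
   m! (deleting blocks of negative primes to compensate); the best ratio of lengths
   is then an optimum over a finitely generated monoid of pairs (Dickson's lemma),
   hence attained by some p/q, and undoing the replacement costs only boundedly many
   atoms, so lengths q n + O(1) and at least p n occur in a common set of lengths.
   This gives the rational elasticity, the bounded growth of rho_k and, with the
   finiteness of the set of distances, the structure of the unions V_k.

   If the classes are unbounded in both directions, fix primes of classes e and -f
   and take primes of classes g and -h with h >> g >> 1. The product of the atom
   supported on g, -f and the atom supported on e, -h contains the atom w supported
   on e, -f, and every factorization other than the obvious one of length 2 is long.
   So all of (b) to (h) fail. *)

Set Implicit Arguments.
Unset Strict Implicit.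
Unset Printing Implicit Defensive.

Import Order.TTheory GRing.Theory Num.Theory.

Local Open Scope classical_set_scope.
Local Open Scope mset_scope.
Local Open Scope ring_scope.

(** * Sums over multisets *)

(** The homomorphism out of the free monoid that extends [f]; class sums, contents of factorizations
    and counts of primes are all of this form. *)
Definition msum (K : choiceType) (M : nmodType) (f : K -> M) (x : {mset K}) : M :=
  \sum_(p <- x) f p.

Section MultisetSums.
Variable K : choiceType.
Implicit Types (x y u v : {mset K}) (p : K).

Lemma mset_addE x y p : (x + y) p = (x p + y p)%N.
Proof. by rewrite [x + y]/(msetD x y) msetE2. Qed.

Lemma mset_zeroE p : (0 : {mset K}) p = 0%N.
Proof. exact: mset0E. Qed.

Lemma msetD_addE x y : msetD x y = x + y. Proof. by []. Qed.

Lemma mset_ext x y : (forall p, x p = y p) -> x = y.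
Proof. by move=> e; apply/msetP. Qed.

Lemma mset_ind (Q : {mset K} -> Prop) :
  Q 0 -> (forall p x, Q x -> Q ([mset p] + x)) -> forall x, Q x.
Proof.
move=> Q0 QS x; rewrite -[x]seq_mset_id; elim: (enum_mset x) => [|p s IH].
  suff -> : seq_mset [::] = 0 :> {mset K} by [].
  by apply: mset_ext => p; rewrite mset_seqE mset_zeroE.
by rewrite mset_cons; apply: QS.
Qed.

Lemma mset_addr_eq0 x y : x + y = 0 -> x = 0 /\ y = 0.
Proof.
move=> e; split; apply: mset_ext => p; have := mset_addE x y p;
  rewrite e mset_zeroE; lia.
Qed.

Lemma mset_addKl x y z : x + y = x + z -> y = z.
Proof. exact: (@cmon_addrI {mset K}). Qed.

Lemma mset1D_neq0 p x : [mset p] + x <> 0.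
Proof.
by move=> /(congr1 (fun z : {mset K} => z p)); rewrite mset_addE msetnxx mset_zeroE.
Qed.

Lemma mset_subD x y : x `<=` y -> exists c, y = x + c.
Proof. by move=> xy; exists (y `\` x); rewrite -msetD_addE msetBDKC. Qed.

Lemma mset_inD x p : p \in x -> exists c, x = [mset p] + c.
Proof. by rewrite -msub1set => /mset_subD. Qed.

Lemma mset_memD p c : p \in ([mset p] + c : {mset K}).
Proof. exact: mset1D1. Qed.

Lemma mset_neq0D x : x <> 0 -> exists p c, x = [mset p] + c.
Proof.
by case: (mset_0Vmem x) => [->//|[p /mset_inD[c ->]]] _; exists p, c.
Qed.

Lemma mset1_refine p x y z : [mset p] + x = y + z ->
  (exists y', y = [mset p] + y' /\ x = y' + z) \/
  (exists z', z = [mset p] + z' /\ x = y + z').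
Proof.
move=> e; have : p \in y + z by rewrite -e mset_memD.
rewrite in_msetD => /orP[] /mset_inD[c ce]; [left|right]; exists c; split=> //;
  apply: (@mset_addKl [mset p]); rewrite e ce; first by rewrite addrA.
by rewrite addrCA.
Qed.

Lemma in_msetDE p x y : (p \in (x + y : {mset K})) = (p \in x) || (p \in y).
Proof. exact: in_msetD. Qed.

Lemma size_msetD x y : size (x + y : {mset K}) = (size x + size y)%N.
Proof.
rewrite -size_cat; apply/perm_size/allP => a _ /=.
by rewrite count_cat !count_mem_mset mset_addE.
Qed.

Lemma size_mset_zero : size (0 : {mset K}) = 0%N.
Proof. exact: size_mset0. Qed.

Lemma size_mset1 p : size [mset p] = 1%N.
Proof. by rewrite enum_msetn. Qed.

Lemma size_mset_eq0P x : size x = 0%N -> x = 0.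
Proof. by move/eqP; rewrite size_mset_eq0 => /eqP. Qed.

Section Sums.
Variables (M : nmodType) (f : K -> M).

Lemma msumD x y : msum f (x + y) = msum f x + msum f y.
Proof.
rewrite /msum -big_cat /=; apply/perm_big/allP => a _ /=.
by rewrite count_cat !count_mem_mset mset_addE.
Qed.

Lemma msum0 : msum f 0 = 0.
Proof. exact: big_mset0. Qed.

Lemma msum1 p : msum f [mset p] = f p.
Proof. by rewrite /msum enum_msetn big_seq1. Qed.

Lemma eq_msum (g : K -> M) x : {in x, f =1 g} -> msum f x = msum g x.
Proof. by move=> e; apply: eq_big_seq. Qed.

End Sums.

Lemma msumMn (M : nmodType) (f : K -> M) x n : msum f (x *+ n) = msum f x *+ n.
Proof. by elim: n => [|n IH]; rewrite ?msum0 // !mulrS msumD IH. Qed.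

Lemma size_msetMn x n : size (x *+ n : {mset K}) = (size x * n)%N.
Proof. by elim: n => [|n IH]; rewrite ?muln0 ?size_mset_zero // mulrS size_msetD IH mulnS. Qed.

Lemma mset_MnE x n p : (x *+ n) p = (x p * n)%N.
Proof. by elim: n => [|n IH]; rewrite ?muln0 ?mset_zeroE // mulrS mset_addE IH mulnS. Qed.

Lemma msum_lt0_ex (s : K -> int) x : msum s x < 0 -> exists p c, x = [mset p] + c /\ s p < 0.
Proof.
elim/mset_ind: x => [|p x IH]; first by rewrite msum0.
rewrite msumD msum1 => h; have [sp|sp] := ltP (s p) 0; first by exists p, x.
have /IH[q [c [-> sq]]] : msum s x < 0 by lia.
by exists q, ([mset p] + c); split=> //; rewrite addrCA.
Qed.

End MultisetSums.

Lemma msum_msum (A K : choiceType) (M : nmodType) (ct : A -> {mset K}) (f : K -> M) z :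
  msum f (msum ct z) = msum (fun u => msum f (ct u)) z.
Proof.
by elim/mset_ind: z => [|u z IH]; rewrite ?msum0 // !msumD !msum1 IH.
Qed.

Lemma mem_msum (A K : choiceType) (ct : A -> {mset K}) z p : p \in msum ct z ->
  exists u z', z = [mset u] + z' /\ p \in ct u.
Proof.
elim/mset_ind: z => [|u z IH]; first by rewrite msum0 in_mset0.
rewrite msumD msum1 in_msetDE => /orP[pu|/IH[v [z' [-> pv]]]]; first by exists u, z.
by exists v, ([mset u] + z'); split=> //; rewrite addrCA.
Qed.

(** The common factor [z] divides the gcd, so only [x] and [y] contribute to the distance. *)
Lemma fm_distDr (K : choiceType) (x y z : {mset K}) :
  (fm_dist (x + z)%R (y + z)%R <= maxn (size x) (size y))%N.
Proof.
have le (a b c : {mset K}) : (size (((a + c) `\` ((a + c) `&` (b + c)))%R) <= size a)%N.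
  have /mset_subD[d e] : ((a + c) `\` ((a + c) `&` (b + c))) `<=` a.
    by apply/msubsetP => p; rewrite !msetE2 ?mset_addE; lia.
  by rewrite [in leqRHS]e size_msetD leq_addr.
rewrite /fm_dist geq_max !leq_max le /=.
by rewrite msetIC le orbT.
Qed.

Lemma fm_distDl (K : choiceType) (x y z : {mset K}) :
  fm_dist (z + x) (z + y) = fm_dist x y.
Proof.
by rewrite /fm_dist; congr maxn; congr (size (enum_mset _)); apply: mset_ext => p;
  rewrite !msetE2 ?mset_addE; lia.
Qed.

Lemma fm_dist_ge (K : choiceType) (x y : {mset K}) : (size y <= size x + fm_dist x y)%N.
Proof.
have ey : y = (y `\` (x `&` y)) + (x `&` y).
  by apply: mset_ext => p; rewrite ?mset_addE !msetE2; lia.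
have ex : x = (x `\` (x `&` y)) + (x `&` y).
  by apply: mset_ext => p; rewrite ?mset_addE !msetE2; lia.
have := congr1 (fun z : {mset K} => size z) ey.
have := congr1 (fun z : {mset K} => size z) ex.
by rewrite !size_msetD /fm_dist; lia.
Qed.

(** * Zero-sum multisets and Lambert's bound *)

Section ZeroSums.
Variables (P : choiceType) (s : P -> int).
Implicit Types (x y c : {mset P}) (p q : P).

Local Notation sigma := (msum s).

(** The sum of [x] is left free, so that Lambert's bound covers atoms as well as zero-sum free
    multisets of nonpositive sum. *)
Definition indecomposable x :=
  forall y c, x = y + c -> sigma y = 0 -> y = 0 \/ c = 0.

Definition zs_atom x := [/\ x <> 0, sigma x = 0 & indecomposable x].

Definition zs_free x := forall y c, x = y + c -> sigma y = 0 -> y = 0.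

(** Primes of class 0 are counted too, so that every nonempty zero-sum multiset has a positive
    count. *)
Definition nneg_count x : nat := msum (fun p => nat_of_bool (0 <= s p)%R) x.

Lemma nneg_countD x y : nneg_count (x + y) = (nneg_count x + nneg_count y)%N.
Proof. exact: msumD. Qed.

Lemma nneg_count0 : nneg_count 0 = 0%N.
Proof. exact: msum0. Qed.

Lemma nneg_count1 p : nneg_count [mset p] = (0 <= s p)%R.
Proof. exact: msum1. Qed.

Lemma nneg_count_eq0 x p : nneg_count x = 0%N -> p \in x -> s p < 0.
Proof.
move=> x0 /mset_inD[c xE]; move: x0; rewrite xE nneg_countD nneg_count1.
by case: leP; lia.
Qed.

Lemma nneg_count0_le x : nneg_count x = 0%N -> sigma x <= 0.
Proof.
elim/mset_ind: x => [|p x IH]; first by rewrite msum0.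
rewrite nneg_countD nneg_count1 msumD msum1; case: leP => sp /=; rewrite ?add1n ?add0n //.
by move=> /IH; lia.
Qed.

Lemma nneg_count0_lt x : nneg_count x = 0%N -> x <> 0 -> sigma x < 0.
Proof.
move=> x0 /mset_neq0D[p [c xE]]; move: x0; rewrite xE nneg_countD nneg_count1.
rewrite msumD msum1; case: (leP 0 (s p)) => sp /=; rewrite ?add1n ?add0n // => /nneg_count0_le; lia.
Qed.

Lemma nneg_count_gt0 x : sigma x = 0 -> x <> 0 -> (0 < nneg_count x)%N.
Proof.
by move=> sx x0; rewrite lt0n; apply/eqP => /nneg_count0_lt/(_ x0); rewrite sx.
Qed.

Lemma nneg_split x : exists y c, [/\ x = y + c, nneg_count c = 0%N,
  size y = nneg_count x, (forall p, p \in y -> 0 <= s p) & sigma c <= 0].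
Proof.
elim/mset_ind: x => [|p x [y [c [-> c0 sy py sc]]]].
  exists 0, 0; rewrite !addr0 nneg_count0 size_mset_zero msum0; split => // p.
  by rewrite in_mset0.
rewrite nneg_countD nneg_count1; case: (leP 0 (s p)) => sp /=.
  exists ([mset p] + y), c; rewrite addrA size_msetD size_mset1 sy; split=> // q.
  by rewrite in_msetDE => /orP[|/py//]; rewrite in_mset1 => /eqP->.
exists y, ([mset p] + c); rewrite nneg_countD nneg_count1 leNgt sp c0; split=> //.
- by rewrite addrCA.
- by rewrite msumD msum1; lia.
Qed.

Lemma zs_free_indec x : zs_free x -> indecomposable x.
Proof. by move=> h y c e sy; left; apply: h e sy. Qed.

Lemma zs_free_reduce x : exists y c, [/\ x = y + c, zs_free y & sigma c = 0].
Proof.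
have [n] := ubnP (size x); elim: n x => // n IH x lt_x_n.
have [fx|] := pselect (zs_free x); first by exists x, 0; rewrite addr0 msum0.
move=> /existsNP[a /existsNP[b /not_implyP[xE /not_implyP[sa a0]]]].
have a1 : size a <> 0%N by move/size_mset_eq0P.
have /IH[y [c [bE fy sc]]] : (size b < n)%N by move: lt_x_n; rewrite xE size_msetD; lia.
exists y, (a + c); rewrite msumD sa sc; split=> //.
by rewrite xE bE addrCA.
Qed.

Section Lambert.
Variable m : nat.
Hypothesis s_ge : forall p, - m%:Z <= s p.
Hypothesis m_gt0 : (0 < m)%N.

(** While the sum is positive, the remainder contains a negative prime. Adding it lowers the sum by
    at most [m], so the sum cannot jump over the window from [- m + 1] to 0. *)
Lemma descend_partial_sum (r y : {mset P}) : - m%:Z < sigma y -> sigma (y + r) <= 0 ->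
  exists n r', [/\ r = n + r', nneg_count n = 0%N & - m%:Z < sigma (y + n) <= 0].
Proof.
have [k] := ubnP (size r); elim: k r y => // k IH r y lt_r sy syr.
have [sy0|sy0] := leP (sigma y) 0.
  by exists 0, r; rewrite add0r nneg_count0 addr0 sy sy0.
have /msum_lt0_ex[q [c [rE sq]]] : sigma r < 0 by move: syr; rewrite msumD; lia.
have := s_ge q => sqm.
have [||| n [r' [cE n0 sn]]] := IH c (y + [mset q]).
- by move: lt_r; rewrite rE size_msetD size_mset1.
- by rewrite msumD msum1; lia.
- by rewrite -addrA -rE.
exists ([mset q] + n), r'; rewrite rE cE addrA nneg_countD n0 nneg_count1 leNgt sq.
by split=> //; rewrite addrA.
Qed.

(** One more nonnegative prime keeps the sum above [- m]; negative primes then bring it back into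
    the window. The nested partial sums are thus indexed by their number of nonnegative primes. *)
Lemma partial_sums x : sigma x <= 0 -> forall k, (k <= nneg_count x)%N ->
  exists y : nat -> {mset P},
    (forall i, (i <= k)%N -> exists c, [/\ x = y i + c, nneg_count (y i) = i &
        - m%:Z < sigma (y i) <= 0]) /\
    (forall i j, (i <= j <= k)%N -> exists d, y j = y i + d).
Proof.
move=> sx; elim=> [|k IH] lek.
  exists (fun=> 0); split=> [i|i j _]; last by exists 0; rewrite addr0.
  rewrite leqn0 => /eqP->; exists x; rewrite add0r nneg_count0 msum0; split=> //.
  by rewrite lexx andbT; lia.
have [y [y1 y2]] := IH (ltnW lek).
have [c [xE yk /andP[sk1 sk2]]] := y1 k (leqnn k).
have [a [b [cE b0 szb ab _]]] := nneg_split c.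
have /mset_neq0D[p [a' aE]] : a <> 0.
  by move=> a0; move: lek szb; rewrite xE nneg_countD yk cE a0 add0r b0 size_mset_zero; lia.
have sp : 0 <= s p by apply: ab; rewrite aE mset_memD.
have [||n [r [rE n0 sn]]] := @descend_partial_sum (a' + b) (y k + [mset p]).
- by rewrite msumD msum1; lia.
- by move: sx; rewrite xE cE aE !addrA.
exists (fun i => if (i <= k)%N then y i else y k + [mset p] + n); split.
  move=> i; rewrite leq_eqVlt ltnS => /orP[/eqP->|ik]; last by rewrite ik; apply: y1.
  rewrite ltnn; exists r; rewrite !nneg_countD nneg_count1 yk n0 sp; split=> //.
    by rewrite xE cE aE -!addrA; congr (_ + _); congr (_ + _).
  by rewrite addn0 addn1.
move=> i j /andP[ij jk]; case: ifP => jk'; case: ifP => ik.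
- by apply: y2; rewrite ij.
- by move: ik; rewrite (leq_trans ij jk').
- have [d ykE] : exists d, y k = y i + d by apply: y2; rewrite ik leqnn.
  by exists (d + [mset p] + n); rewrite ykE -!addrA.
- by exists 0; rewrite addr0.
Qed.

(* Lambert's bound: of more than [m] nested partial sums in the window of length
   [m], two coincide, and their difference is a zero-sum part. *)
Lemma nneg_count_indecomposable x : indecomposable x -> sigma x <= 0 ->
  (nneg_count x <= m)%N.
Proof.
move=> xI sx; rewrite leqNgt; apply/negP => ltmx.
have [y [y1 y2]] := partial_sums sx (ltnW ltmx).
(* Pigeonhole: the [m + 1] sums for [i] from 0 to [m] have absolute values below [m], so the
   reduction modulo [m] changes nothing and only provides the type. *)
pose f (i : 'I_m.+1) : 'I_m := Ordinal (ltn_pmod `|sigma (y i)|%N m_gt0).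
have : ~~ injectiveb f.
  by apply/negP => /injectiveP/leq_card; rewrite !card_ord ltnn.
move=> /injectivePn[i [j ij fij]].
wlog ltij : i j ij fij / (i < j)%N => [wl|].
  case: (ltngtP i j) => [|h|/val_inj h]; first exact: wl ij fij.
    by apply: (wl j i) => //; rewrite eq_sym.
  by rewrite h eqxx in ij.
have lej : (j <= m)%N by rewrite -ltnS.
have lei : (i <= m)%N by rewrite -ltnS.
have [ci [_ wi si]] := y1 i lei.
have [cj [xE wj sj]] := y1 j lej.
have [|d yE] := y2 i j; first by rewrite (ltnW ltij).
have sij : sigma (y i) = sigma (y j).
  by move/(congr1 val): fij => /=; rewrite !modn_small; lia.
have sd : sigma d = 0 by move: sij; rewrite yE msumD; lia.
have := wj; rewrite yE nneg_countD wi => wd.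
(* The part [d] contains [j - i] nonnegative primes, at least one and at most [m], so neither [d]
   nor its complement in [x] is empty. *)
have [|d0|c0] := xI d (y i + cj) _ sd.
- by rewrite xE yE addrCA addrA.
- by move: wd; rewrite d0 nneg_count0; lia.
- by move: ltmx; rewrite xE yE -addrA addrCA c0 addr0; lia.
Qed.

End Lambert.

End ZeroSums.

(** * Chains of factorizations *)

Definition atom_param (P A : choiceType) (s : P -> int) (ct : A -> {mset P}) : Prop :=
  [/\ injective ct, (forall u, zs_atom s (ct u)) &
      forall x, zs_atom s x -> exists u, ct u = x].

Lemma msum_opp (P : choiceType) (s : P -> int) x : msum (fun p => - s p) x = - msum s x.
Proof. by elim/mset_ind: x => [|p x IH]; rewrite ?msum0 ?oppr0 // !msumD !msum1 IH opprD. Qed.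

(** Negating all classes keeps the zero-sum multisets, so only classes bounded below need to be
    treated. *)
Lemma atom_param_opp (P A : choiceType) (s : P -> int) (ct : A -> {mset P}) :
  atom_param s ct -> atom_param (fun p => - s p) ct.
Proof.
have e x : zs_atom (fun p => - s p) x <-> zs_atom s x.
  split=> -[x0 sx xI]; split=> //.
  - by move: sx; rewrite msum_opp => /eqP; rewrite oppr_eq0 => /eqP.
  - by move=> y c xE sy; apply: xI xE _; rewrite msum_opp sy oppr0.
  - by rewrite msum_opp sx oppr0.
  - move=> y c xE; rewrite msum_opp => /eqP; rewrite oppr_eq0 => /eqP; exact: xI.
by move=> [ci ca cs]; split=> // [u|x /e/cs//]; apply/e.
Qed.

Section Chains.
Variables (P A : choiceType) (ct : A -> {mset P}).
Implicit Types z : {mset A}.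

Definition chain (N : nat) z z' := exists r : seq {mset A},
  [/\ {in r, forall y, msum ct y = msum ct z},
      path (fun x y => (fm_dist x y <= N)%N) z r & last z r = z'].

Lemma chain_refl N z : chain N z z.
Proof. by exists [::]. Qed.

Lemma chain_cont N z z' : chain N z z' -> msum ct z' = msum ct z.
Proof.
move=> [r [rz _ <-]]; case/lastP: r rz => // r y rz.
by rewrite last_rcons; apply: rz; rewrite mem_rcons inE eqxx.
Qed.

Lemma chain_trans N z1 z2 z3 : chain N z1 z2 -> chain N z2 z3 -> chain N z1 z3.
Proof.
move=> c12 [r' [r'z pr' <-]]; have e := chain_cont c12; case: c12 => r [rz pr lr].
exists (r ++ r'); rewrite cat_path last_cat lr pr pr'; split=> // y.
by rewrite mem_cat => /orP[/rz//|/r'z ->].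
Qed.

Lemma chain_step N z z' : msum ct z' = msum ct z -> (fm_dist z z' <= N)%N -> chain N z z'.
Proof.
by move=> e d; exists [:: z']; rewrite /= d; split=> // y; rewrite inE => /eqP->.
Qed.

Lemma chain_addl N y z z' : chain N z z' -> chain N (y + z) (y + z').
Proof.
move=> [r [rz pr <-]]; exists [seq y + x | x <- r]; split.
- by move=> _ /mapP[x /rz xz ->]; rewrite !msumD xz.
- by rewrite path_map; apply: sub_path pr => a b /=; rewrite fm_distDl.
- by rewrite last_map.
Qed.

End Chains.

Section Factorizations.
Variables (P A : choiceType) (s : P -> int) (ct : A -> {mset P}).
Hypothesis Hct : atom_param s ct.
Implicit Types (x y c g r : {mset P}) (p q : P) (z zb : {mset A}) (u v : A).

Local Notation sigma := (msum s).
Local Notation cont := (msum ct).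
Local Notation w := (nneg_count s).

Lemma ct_sum0 u : sigma (ct u) = 0.
Proof. by case: Hct => _ /(_ u)[]. Qed.

Lemma ct_neq0 u : ct u <> 0.
Proof. by case: Hct => _ /(_ u)[]. Qed.

Lemma cont_sum0 z : sigma (cont z) = 0.
Proof.
by elim/mset_ind: z => [|u z IH]; rewrite ?msum0 // !msumD msum1 ct_sum0 IH.
Qed.

Lemma cont_eq0 z : cont z = 0 -> z = 0.
Proof.
have [->//|/mset_neq0D[u [c ->]]] := pselect (z = 0).
by rewrite msumD msum1 => /mset_addr_eq0[/ct_neq0].
Qed.

Lemma factorization_exists x : sigma x = 0 -> exists z, cont z = x.
Proof.
have [n] := ubnP (size x); elim: n x => // n IH x lt_x sx.
have [->|x0] := pselect (x = 0); first by exists 0; rewrite msum0.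
have [xI|] := pselect (indecomposable s x).
  have [_ _ /(_ x)[//|u <-]] := Hct.
  by exists [mset u]; rewrite msum1.
move=> /existsNP[y /existsNP[c /not_implyP[xE /not_implyP[sy /not_orP[y0 c0]]]]].
have sc : sigma c = 0 by move: sx; rewrite xE msumD sy add0r.
have ny : size y <> 0%N by move=> /size_mset_eq0P.
have nc : size c <> 0%N by move=> /size_mset_eq0P.
have [||z1 e1] := IH y; rewrite ?sy //; first by move: lt_x; rewrite xE size_msetD; lia.
have [||z2 e2] := IH c; rewrite ?sc //; first by move: lt_x; rewrite xE size_msetD; lia.
by exists (z1 + z2); rewrite msumD e1 e2.
Qed.

Lemma cont_atom z u : cont z = ct u -> z = [mset u].
Proof.
case: Hct => ci ca _; have [->|/mset_neq0D[v [z' ->]]] := pselect (z = 0).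
  by rewrite msum0 => /esym/ct_neq0.
rewrite msumD msum1 => /esym e; have [_ _ /(_ _ _ e (ct_sum0 v))] := ca u.
move=> [/ct_neq0//|/cont_eq0 z0]; move: e; rewrite z0 msum0 addr0 => /ci->.
by rewrite addr0.
Qed.

Lemma cont_cover x y z : cont z = x + y -> exists z0 z1 c,
  [/\ z = z0 + z1, (size z0 <= size x)%N & cont z0 = x + c].
Proof.
elim/mset_ind: x y => [|p x IH] y.
  by exists 0, z, 0; rewrite msum0 !addr0 add0r; split; rewrite ?size_mset_zero.
rewrite -addrA addrCA => e; have [z0 [z1 [c [zE szz0 e0]]]] := IH _ e.
have : [mset p] + y = c + cont z1.
  by apply: (@mset_addKl _ x); rewrite -e zE msumD e0 addrA.
move=> /mset1_refine[[c' [cE _]]|[c' [cE _]]].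
  exists z0, z1, c'; rewrite e0 cE zE size_msetD size_mset1; split=> //.
    exact: leq_trans szz0 (leq_addl _ _).
  by rewrite addrCA addrA.
have /mem_msum[u [z2 [z1E /mset_inD[d dE]]]] : p \in cont z1 by rewrite cE mset_memD.
exists ([mset u] + z0), z2, (c + d).
rewrite zE z1E addrCA addrA !size_msetD !size_mset1 msumD msum1 e0 dE; split=> //.
by rewrite [c + d]addrC !addrA [[mset p] + _ + _]addrAC.
Qed.

Section Bounded.
Variable m : nat.
Hypothesis s_ge : forall p, - m%:Z <= s p.
Hypothesis m_gt0 : (0 < m)%N.

Lemma nneg_count_ct u : (0 < w (ct u) <= m)%N.
Proof.
case: Hct => _ /(_ u)[u0 su uI] _; rewrite nneg_count_gt0 //=.
by apply: (nneg_count_indecomposable s_ge); rewrite ?su.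
Qed.

Lemma size_le_nneg_count z : (size z <= w (cont z) <= m * size z)%N.
Proof.
elim/mset_ind: z => [|u z IH]; first by rewrite msum0 nneg_count0 size_mset_zero.
rewrite msumD msum1 nneg_countD size_msetD size_mset1.
by have := nneg_count_ct u; rewrite mulnDr muln1; lia.
Qed.

Lemma size_factorizations z z' : cont z = cont z' -> (size z' <= m * size z)%N.
Proof.
by move=> e; have := size_le_nneg_count z'; have := size_le_nneg_count z; rewrite e; lia.
Qed.

(** Only the atoms covering [u], at most [size (ct u)] of them, are changed: the rest [c] of their
    product has sum 0 and is factored anew. *)
Lemma tame_exchange u y z : cont z = ct u + y ->
  exists z', cont ([mset u] + z') = ct u + y /\
    (fm_dist z ([mset u] + z')%R <= (m * size (ct u)).+1)%N.
Proof.
move=> e; have [z0 [z1 [c [zE sz0 e0]]]] := cont_cover e.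
have sc : sigma c = 0.
  by have := cont_sum0 z0; rewrite e0 msumD ct_sum0 add0r.
have [zc ec] := factorization_exists sc.
exists (zc + z1).
have e1 : cont ([mset u] + zc) = cont z0 by rewrite msumD msum1 ec e0.
rewrite addrA; split; first by rewrite msumD e1 -msumD -zE.
rewrite zE; apply: leq_trans (fm_distDr _ _ _) _.
have := size_factorizations (esym e1); rewrite size_msetD.
have : (m * size z0 <= m * size (ct u))%N by rewrite leq_pmul2l.
have : (size z0 <= m * size z0)%N by rewrite leq_pmull.
by lia.
Qed.

(** A maximal zero-sum part [h] of the surplus is split off. The rest [g + e] has at most [2 m]
    nonnegative primes, hence at most [2 m] atoms in any factorization. *)
Lemma chain_refactor u g r c zb z1 : (size zb <= m.*2.+1)%N -> cont zb = g + c ->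
    ct u = g + r -> w r = 0%N ->
  exists zw zh e, [/\ cont zw = g + e, zs_free s e, (size zw <= m.*2)%N &
    chain ct (m * m.*2.+1) (zb + z1) (zw + (zh + z1))].
Proof.
move=> szb eb uE wr; have [e [h [cE fe sh]]] := zs_free_reduce s c.
have sge : sigma (g + e) = 0.
  by have := cont_sum0 zb; rewrite eb cE addrA (msumD _ _ h) sh addr0.
have [zw ew] := factorization_exists sge.
have [zh eh] := factorization_exists sh.
have econt : cont (zw + zh) = cont zb by rewrite msumD ew eh eb cE addrA.
exists zw, zh, e; split=> //.
  have /andP[le_zw _] := size_le_nneg_count zw; apply: leq_trans le_zw _.
  rewrite ew nneg_countD.
  (* Both [g + e] and [g + r] have sum 0, so [e] has the same nonpositive sum as [r]. *)
  have se : sigma e <= 0.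
    have := ct_sum0 u; have := nneg_count0_le wr; move: sge; rewrite uE !msumD; lia.
  have := nneg_count_indecomposable s_ge m_gt0 (zs_free_indec fe) se.
  by have := nneg_count_ct u; rewrite uE nneg_countD; lia.
rewrite addrA; apply: chain_step; first by rewrite (msumD _ (zw + zh)) econt -msumD.
apply: leq_trans (fm_distDr _ _ _) _; rewrite geq_max.
have h1 := size_factorizations (esym econt).
have h2 : (m * size zb <= m * m.*2.+1)%N by rewrite leq_pmul2l.
have h3 : (size zb <= m * size zb)%N by rewrite leq_pmull.
by rewrite (leq_trans h1 h2) (leq_trans h3 h2).
Qed.

Lemma chain_extract_rec u y r g c zb z1 : (size zb <= m.*2.+1)%N -> cont zb = g + c ->
    ct u = g + r -> w r = 0%N -> cont (zb + z1) = ct u + y ->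
  exists z2, chain ct (m * m.*2.+1) (zb + z1) ([mset u] + z2).
Proof.
elim/mset_ind: r g c zb z1 => [|q r IH] g c zb z1 szb eb uE wr ey.
  have [zw [zh [e [ew fe szw ch]]]] := chain_refactor z1 szb eb uE wr.
  (* Once [g] is all of [u], the surplus [e] has sum 0 and is zero-sum free, hence empty; so [zw] is
     the atom [u] alone. *)
  have e0 : e = 0.
    apply: (fe e 0); rewrite ?addr0 //; move: (cont_sum0 zw) (ct_sum0 u).
    by rewrite ew uE addr0 msumD => + g0; rewrite g0 add0r.
  have -> : [mset u] = zw by apply/esym/cont_atom; rewrite ew uE e0.
  by exists (zh + z1).
have [zw [zh [e [ew fe szw ch]]]] := chain_refactor z1 szb eb uE wr.
have := wr; rewrite nneg_countD => /eqP; rewrite addn_eq0 => /andP[/eqP wq /eqP wr'].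
have {}uE : ct u = [mset q] + g + r by rewrite uE addrA [g + _]addrC.
have ey' : cont (zw + (zh + z1)) = ct u + y by rewrite (chain_cont ch).
have : [mset q] + (r + y) = e + cont (zh + z1).
  apply: (@mset_addKl _ g); rewrite [RHS]addrA -ew -msumD ey' uE -!addrA.
  by rewrite addrCA.
move=> /mset1_refine[[e' [eE _]]|[d [dE _]]].
  have [|z2 ch'] := IH ([mset q] + g) e' zw (zh + z1) (leqW szw) _ uE wr' ey'.
    by rewrite ew eE addrCA addrA.
  by exists z2; apply: chain_trans ch ch'.
have /mem_msum[v [z3 [z3E /mset_inD[f fE]]]] : q \in cont (zh + z1).
  by rewrite dE mset_memD.
have [|||z2 ch'] := IH ([mset q] + g) (e + f) (zw + [mset v]) z3 _ _ uE wr'.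
- by rewrite size_msetD size_mset1 addn1 ltnS.
- by rewrite msumD msum1 ew fE addrACA [g + _]addrC.
- by rewrite -addrA -z3E.
by exists z2; apply: chain_trans ch _; rewrite z3E addrA.
Qed.

(* To bring the atom [u] into a factorization, first collect its nonnegative
   part in boundedly many atoms, then its negative primes one at a time; after
   each step the part outside [u] is made zero-sum free, and Lambert's bound
   keeps the number of atoms involved bounded. *)
Lemma chain_extract u y z : cont z = ct u + y ->
  exists z2, chain ct (m * m.*2.+1) z ([mset u] + z2).
Proof.
move=> e; have [g [r [uE wr sg _ _]]] := nneg_split s (ct u).
have [z0 [z1 [c [zE sz0 e0]]]] : exists z0 z1 c,
    [/\ z = z0 + z1, (size z0 <= size g)%N & cont z0 = g + c].
  by apply: (@cont_cover g (r + y)); rewrite e uE addrA.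
rewrite zE; apply: chain_extract_rec e0 uE wr _; last by rewrite -zE; exact: e.
by have := nneg_count_ct u; move: sz0; rewrite sg; lia.
Qed.

Lemma chain_bounded z z' : cont z = cont z' -> chain ct (m * m.*2.+1) z z'.
Proof.
elim/mset_ind: z' z => [|u z' IH] z e.
  by rewrite msum0 in e; rewrite (cont_eq0 e); apply: chain_refl.
rewrite msumD msum1 in e; have [z2 ch] := chain_extract e.
have ec := chain_cont ch; apply: chain_trans ch _; apply/chain_addl/IH.
by move: ec; rewrite msumD msum1 e => /mset_addKl.
Qed.

End Bounded.
End Factorizations.

(** * Optimal ratios of lengths *)

Lemma finite_nat_bounded (A : set nat) : finite_set A -> exists N, forall n, A n -> (n <= N)%N.
Proof.
move=> /finite_seqP[r ->]; exists (\max_(i <- r) i)%N => n /= nr.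
exact: (@leq_bigmax_seq _ r xpredT id).
Qed.

(* Dickson's lemma, for the product order pulled back along finitely many
   coordinate functions. *)
Lemma dickson (T : Type) (phi : nat -> T -> nat) r (S : set T) :
  exists F : set T, [/\ finite_set F, (F `<=` S)%classic &
    forall x, S x -> exists2 f, F f & forall i, (i < r)%N -> (phi i f <= phi i x)%N].
Proof.
elim: r S => [|r IH] S.
  have [[x Sx]|S0] := pselect (exists x, S x).
    by exists [set x]; split=> [|_ ->//|y _]; [exact: finite_set1 | exists x].
  by exists set0; split=> // x Sx; case: S0; exists x.
have [F [Ffin FS FP]] := IH S.
(* Elements whose last coordinate is at least [N] lie above an element of [F]. The others fall into
   finitely many slices where this coordinate is constant. *)
have [N NP] : exists N, forall f, F f -> (phi r f <= N)%N.
  have [N h] := finite_nat_bounded (finite_image (phi r) Ffin).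
  by exists N => f Ff; apply: h; exists f.
have /choice[G GP] v := IH [set x | S x /\ phi r x = v].
exists (F `|` \bigcup_(v in `I_N) G v)%classic; split.
- rewrite finite_setU; split=> //; apply: bigcup_finite => [|v _]; first exact: finite_II.
  by have [] := GP v.
- by rewrite subUset; split=> // x [v _ Gx]; have [_ /(_ x Gx)[]] := GP v.
move=> x Sx; have [ltxN|leNx] := ltnP (phi r x) N.
  have [_ sub /(_ x)[//|f Gf fP]] := GP (phi r x).
  exists f; first by right; exists (phi r x).
  move=> i; rewrite ltnS leq_eqVlt => /orP[/eqP->|]; last exact: fP.
  by have [_ ->] := sub f Gf.
have [f Ff fP] := FP x Sx; exists f; first by left.
move=> i; rewrite ltnS leq_eqVlt => /orP[/eqP->|]; last exact: fP.
exact: leq_trans (NP f Ff) leNx.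
Qed.

Lemma max_ratio (T : Type) (a b : T -> nat) (F : set T) : finite_set F -> F !=set0 ->
  (forall f, F f -> (0 < b f)%N) ->
  exists2 f, F f & forall g, F g -> (a g * b f <= a f * b g)%N.
Proof.
move=> Ffin [f0 Ff0] bpos.
pose Q f := [set (a g, b g) | g in F] f.
have : finite_set [set (a g, b g) | g in F] by apply: finite_image.
move=> /finite_seqP[r rE].
have rF p : p \in r -> exists2 g, F g & (a g, b g) = p.
  by move=> pr; have : [set (a g, b g) | g in F] p by rewrite rE.
have Fr g : F g -> (a g, b g) \in r.
  by move=> Fg; have : [set (a g, b g) | g in F] (a g, b g) by [exists g|]; rewrite rE.
suff [p pr pP] : exists2 p, p \in r & forall q, q \in r -> (q.1 * p.2 <= p.1 * q.2)%N.
  by have [f Ff fE] := rF p pr; exists f => // g /Fr/pP; rewrite -fE.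
have rb p : p \in r -> (0 < p.2)%N by move=> /rF[g /bpos ? <-].
have : r != [::] by apply/eqP => r0; have := Fr f0 Ff0; rewrite r0.
elim: {rE rF Fr} r rb => // p r IH rb _.
have bp : (0 < p.2)%N by apply: rb; rewrite inE eqxx.
have [r0|r0] := eqVneq r [::].
  by exists p; rewrite ?inE ?eqxx // => q; rewrite r0 inE => /eqP->; rewrite leqnn.
have [|//|q qr qP] := IH; first by move=> q qr; apply: rb; rewrite inE qr orbT.
have bq : (0 < q.2)%N by apply: rb; rewrite inE qr orbT.
have [le|lt] := leqP (p.1 * q.2) (q.1 * p.2).
  exists q; first by rewrite inE qr orbT.
  by move=> g; rewrite inE => /orP[/eqP->//|/qP].
exists p; first by rewrite inE eqxx.
move=> g; rewrite inE => /orP[/eqP->|gr]; first by rewrite mulnC.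
have bg : (0 < g.2)%N by apply: rb; rewrite inE gr orbT.
rewrite -(leq_pmul2r bq) -mulnA [(p.2 * _)%N]mulnC mulnA.
have h1 : (g.1 * q.2 * p.2 <= q.1 * g.2 * p.2)%N by rewrite leq_pmul2r // qP.
apply: leq_trans h1 _; rewrite mulnAC [leqRHS]mulnAC leq_pmul2r //.
exact: ltnW.
Qed.

(** Dickson's lemma provides finitely many pairs with nonempty second component below all such
    pairs; the best ratio among them is taken. Subtracting one of them stays in [X], so induction on
    the second component shows that no pair has a larger ratio. *)
Lemma best_ratio (T : choiceType) (V : seq T) (X : set ({mset T} * {mset T})) y1 y1' :
    (forall y y', X (y, y') -> {subset y <= V} /\ {subset y' <= V}) ->
    (forall a a' b b', X (a + b, a' + b') -> X (a, a') -> X (b, b')) ->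
    (forall y, X (y, 0) -> y = 0) ->
    X (y1, y1') -> y1' <> 0 ->
  exists y0 y0', [/\ X (y0, y0'), y0' <> 0 &
    forall y y', X (y, y') -> (size y * size y0' <= size y0 * size y')%N].
Proof.
move=> XV Xsub Xpos X1 y10; pose n := size V.
have [t0 _] : exists t0 : T, True by have [t [_ _]] := mset_neq0D y10; exists t.
(* The first [n] coordinates are multiplicities in the first component, the next [n] those in the
   second. *)
pose phi i (y : {mset T} * {mset T}) :=
  if (i < n)%N then y.1 (nth t0 V i) else y.2 (nth t0 V (i - n)).
have [F [Ffin FX FP]] := dickson phi (n + n) [set y | X y /\ y.2 <> 0].
have szpos (y : {mset T}) : y <> 0 -> (0 < size y)%N.
  by move=> y0; rewrite lt0n; apply/eqP => /size_mset_eq0P.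
have [||[y0 y0'] Fy0 y0P] :=
  @max_ratio _ (fun y : {mset T} * {mset T} => size y.1) (fun y => size y.2) F Ffin.
- by have [|f Ff _] := FP (y1, y1'); [split | exists f].
- by move=> f /FX[_ /szpos].
have [Xy0 y0n] := FX _ Fy0.
exists y0, y0'; split=> // y y'.
have [k] := ubnP (size y'); elim: k y y' => // k IH y y' lt_k Xy.
have [y'0|y'0] := pselect (y' = 0).
  by move: Xy; rewrite y'0 => /Xpos ->; rewrite !size_mset_zero muln0.
have [//|[f f'] Ff leF] := FP (y, y').
have [Xf fn] := FX _ Ff; have [fV f'V] := XV _ _ Xf.
have le_f : f `<=` y.
  apply/msubsetP => t; case: (boolP (t \in f)) => [/fV tV|]; last by rewrite -mset_eq0 => /eqP->.
  by have := leF (index t V); rewrite /phi index_mem tV nth_index //;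
    apply; rewrite ltn_addr // index_mem.
have le_f' : f' `<=` y'.
  apply/msubsetP => t; case: (boolP (t \in f')) => [/f'V tV|]; last by rewrite -mset_eq0 => /eqP->.
  have := leF (n + index t V)%N.
  have idx_n : (n + index t V < n)%N = false by rewrite ltnNge leq_addr.
  rewrite /phi idx_n addKn nth_index //; apply.
  by rewrite ltn_add2l index_mem.
have [g yE] := mset_subD le_f; have [g' y'E] := mset_subD le_f'.
have Xg : X (g, g') by apply: (Xsub f f') Xf; rewrite -yE -y'E.
rewrite yE y'E !size_msetD mulnDl mulnDr; apply: leq_add; first exact: y0P Ff.
apply: IH Xg; move: lt_k (szpos _ fn); rewrite y'E size_msetD /=; lia.
Qed.

Lemma finite_msets (T : choiceType) (D : set T) k : finite_set D ->
  finite_set [set x : {mset T} | (size x <= k)%N /\ forall p, p \in x -> D p].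
Proof.
move=> Dfin; elim: k => [|k IH].
  apply: (@sub_finite_set _ _ [set 0]); last exact: finite_set1.
  by move=> x [/=]; rewrite leqn0 => /eqP/size_mset_eq0P ->.
set S := [set x : {mset T} | _] in IH.
apply: (@sub_finite_set _ _
  ([set 0] `|` [set ([mset y.1] + y.2 : {mset T})%R | y in (D `*` S)])%classic).
  move=> x [szx xD]; have [->|x0] := pselect (x = 0); first by left.
  have [p [c xE]] := mset_neq0D x0; right; exists (p, c) => //=; split=> /=.
    by apply: xD; rewrite xE mset_memD.
  split=> [|q qc]; last by apply: xD; rewrite xE in_msetDE qc orbT.
  by move: szx; rewrite xE size_msetD size_mset1.
by rewrite finite_setU; split; [exact: finite_set1|apply/finite_image/finite_setX].
Qed.

Section RationalElasticity.
Variables (P A : choiceType) (s : P -> int) (ct : A -> {mset P}).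
Hypothesis Hct : atom_param s ct.
Implicit Types (x y c : {mset P}) (p q : P) (z : {mset A}) (u : A).

Local Notation sigma := (msum s).
Local Notation cont := (msum ct).

(* [p / q] is the elasticity, and [C] bounds the number of extra atoms that are
   needed to come close to it. *)
Definition rational_growth := exists p q C : nat, [/\ (0 < q)%N,
  forall z z', cont z = cont z' -> (size z * q <= p * size z')%N &
  forall n, exists z z', [/\ cont z = cont z', (p * n <= size z)%N &
    (size z' <= q * n + C)%N]].

Section Types.
(** The image of an atom under [kappa] is its type. There are finitely many types, each realized by
    an atom up to a part killed by [kappa]; two killed parts of equal sum can be exchanged, in
    multiples of [e], at the cost of at most [C] atoms. *)
Variable kappa : P -> {mset P}.
Local Notation c := (msum kappa).
Hypothesis V_finite : finite_set (range (c \o ct)).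
Hypothesis V_neq0 : forall u, c (ct u) <> 0.
Hypothesis lift_atom : forall u, exists u' nu, ct u' = c (ct u) + nu /\ c nu = 0.
Hypothesis absorb : exists e C : nat, (0 < e)%N /\ forall nu nu',
  c nu = 0 -> c nu' = 0 -> sigma nu = sigma nu' -> forall n, exists y z',
    [/\ nu *+ (e * n) + y = nu' *+ (e * n) + cont z' & (size z' <= C)%N].

(** An equality of two products of atoms induces a relation between their types, which gives the
    upper bound. Conversely, the best relation lifts to atoms whose products differ only in killed
    parts, and these are absorbed. *)
Lemma types_rational_growth (u0 : A) : rational_growth.
Proof.
have [V VE] : exists V : seq {mset P}, range (c \o ct) = [set` V] by apply/finite_seqP.
have ctV u : c (ct u) \in V.
  have : range (c \o ct) (c (ct u)) by exists u.
  by rewrite VE.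
have Vct v : v \in V -> exists u, c (ct u) = v.
  by move=> vV; have : range (c \o ct) v; [rewrite VE | move=> [u _ <-]; exists u].
pose X := [set y : {mset {mset P}} * {mset {mset P}} |
  [/\ {subset y.1 <= V}, {subset y.2 <= V} & msum id y.1 = msum id y.2]].
pose types z : {mset {mset P}} := msum (fun u => [mset c (ct u)]) z.
have typesD u z : types ([mset u] + z) = [mset c (ct u)] + types z.
  by rewrite /types msumD msum1.
have sz_types z : size (types z) = size z.
  elim/mset_ind: z => [|u z IH]; first by rewrite /types msum0 !size_mset_zero.
  by rewrite typesD !size_msetD IH !size_mset1.
have sum_types z : msum id (types z) = c (cont z).
  by rewrite /types !msum_msum; apply: eq_msum => u _; rewrite msum1.
have typesV z : {subset types z <= V}.
  move=> v /mem_msum[u [z' [_]]]; rewrite in_mset1 => /eqP ->; exact: ctV.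
have lift_types (y : {mset {mset P}}) : {subset y <= V} -> exists z nu,
    [/\ size z = size y, cont z = msum id y + nu & c nu = 0].
  elim/mset_ind: y => [|v y IH] yV.
    by exists 0, 0; rewrite !size_mset_zero !msum0 addr0.
  have [|z [nu [sz ez cz]]] := IH; first by move=> t ty; apply: yV; rewrite in_msetDE ty orbT.
  have [|u uv] := Vct v; first by apply: yV; rewrite mset_memD.
  have [u' [nu' [eu' cu']]] := lift_atom u.
  exists ([mset u'] + z), (nu' + nu); rewrite !size_msetD sz !size_mset1 !msumD !msum1.
  by rewrite ez cz cu' addr0 eu' uv addrACA.
have [|||||y0 [y0' [[yV y'V yE] y0n yP]]] := @best_ratio _ V X (types [mset u0]) (types [mset u0]).
- by move=> y y' [].
- move=> a a' b b' [/= abV abV' abE] [/= _ _ aE]; split=> /=.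
  + by move=> t tb; apply: abV; rewrite in_msetDE tb orbT.
  + by move=> t tb; apply: abV'; rewrite in_msetDE tb orbT.
  + by move: abE; rewrite !msumD aE => /mset_addKl.
- move=> y [/= yV _ yE]; have [//|/mset_neq0D[v [y2 y2E]]] := pselect (y = 0).
  move: yE; rewrite y2E msumD msum1 msum0 => /mset_addr_eq0[v0 _].
  have [|u uv] := Vct v; first by apply: yV; rewrite y2E mset_memD.
  by case: (V_neq0 (u := u)); rewrite uv.
- by split=> //; apply: typesV.
- by rewrite /types msum1 -[[mset _]]addr0; apply: mset1D_neq0.
rewrite /= in yV y'V yE.
have [e [C [e_gt0 absorbP]]] := absorb.
have [z0 [nu [sz ez cnu]]] := lift_types _ yV.
have [z0' [nu' [sz' ez' cnu']]] := lift_types _ y'V.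
(* The ratio is [size y0 / size y0']; the common factor [e] appears because absorption works for
   [e * n] copies. *)
exists (size y0 * e)%N, (size y0' * e)%N, C; split.
- by rewrite muln_gt0 e_gt0 andbT lt0n; apply/eqP => /size_mset_eq0P.
- move=> z z' eqz; rewrite mulnA [leqRHS]mulnAC leq_pmul2r //.
  rewrite -!sz_types; apply: yP; split; try exact: typesV.
  by rewrite /= !sum_types eqz.
move=> n; have snu : sigma nu = sigma nu'.
  have := cont_sum0 Hct z0; have := cont_sum0 Hct z0'.
  by rewrite ez ez' yE !msumD => h1 h2; apply: (@addrI _ (sigma (msum id y0'))); rewrite h1.
have [y [z' [yz' szz']]] := absorbP _ _ cnu cnu' snu n.
have sy : sigma y = 0.
  have := congr1 sigma yz'; rewrite !msumD !msumMn snu (cont_sum0 Hct) => /addrI.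
  by [].
have [z ey] := factorization_exists Hct sy.
exists (z0 *+ (e * n) + z), (z0' *+ (e * n) + z'); split.
- rewrite !msumD !msumMn ez ez' ey yE !mulrnDl -!addrA; congr (_ + _).
  exact: yz'.
- by rewrite size_msetD size_msetMn sz mulnA leq_addr.
- by rewrite size_msetD size_msetMn sz' mulnA leq_add2l.
Qed.

End Types.

End RationalElasticity.

(** * Rationality of the elasticity *)

Lemma mulrn_posz (a : int) k : a *+ k = a * k%:Z.
Proof. by rewrite -mulr_natr natz. Qed.

Lemma mset_take (K : choiceType) (x : {mset K}) k : (k <= size x)%N ->
  exists y c : {mset K}, x = y + c /\ size y = k.
Proof.
elim/mset_ind: x k => [|p x IH] k.
  by rewrite size_mset_zero leqn0 => /eqP->; exists 0, 0; rewrite addr0 size_mset_zero.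
rewrite size_msetD size_mset1; case: k => [_|k /IH[y [c [-> sy]]]].
  by exists 0, ([mset p] + x); rewrite add0r size_mset_zero.
by exists ([mset p] + y), c; rewrite addrA size_msetD size_mset1 sy.
Qed.

Lemma msum_mset1_split (K L : choiceType) (f : K -> L) x y c :
    msum (fun p => [mset f p]) x = y + c ->
  exists y0 c0, [/\ x = y0 + c0, msum (fun p => [mset f p]) y0 = y &
    msum (fun p => [mset f p]) c0 = c].
Proof.
elim/mset_ind: x y c => [|p x IH] y c.
  by rewrite msum0 => /esym/mset_addr_eq0[-> ->]; exists 0, 0; rewrite addr0 msum0.
rewrite msumD msum1 =>
  /mset1_refine[[y' [-> /IH[a [b [-> <- <-]]]]]|[c' [-> /IH[a [b [-> <- <-]]]]]].
  by exists ([mset p] + a), b; rewrite msumD msum1 addrA.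
by exists a, ([mset p] + b); rewrite msumD msum1 addrCA.
Qed.

(** * Relabelling primes of atoms and cutting off blocks of negative primes *)

Section ZeroSumReplacement.
Variables (P : choiceType) (s : P -> int).
Implicit Types (x y c : {mset P}) (p q : P).
Local Notation sigma := (msum s).

(** A splitting of the relabelled multiset comes from a splitting of [x] with the same sums. *)
Lemma zs_atom_relabel (r : P -> P) x : (forall p, s (r p) = s p) -> zs_atom s x ->
  zs_atom s (msum (fun p => [mset r p]) x).
Proof.
move=> rs [x0 sx xI].
have e y : sigma (msum (fun p => [mset r p]) y) = sigma y.
  by rewrite msum_msum; apply: eq_msum => p _; rewrite msum1.
split; last 1 first.
- move=> y c /msum_mset1_split[a [b [xE <- <-]]]; rewrite e => sa.
  by have [->|->] := xI _ _ xE sa; rewrite msum0; [left|right].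
- have [p [c ->]] := mset_neq0D x0; rewrite msumD msum1; exact: mset1D_neq0.
- by rewrite e.
Qed.

(** If some class [- j] occurs at least [L / j] times, these primes form a block of sum [- L].
    Otherwise each of the [k] classes contributes at most [L - 1]. *)
Lemma block_exists L k x : (forall j, (0 < j <= k)%N -> (j %| L)%N) ->
    (forall p, p \in x -> - k%:Z <= s p < 0) ->
  (exists b c, x = b + c /\ sigma b = - L%:Z) \/ - sigma x + k%:Z <= (k * L)%:Z.
Proof.
elim: k x => [|k IH] x dvdL xk.
  right; have [->|/mset_neq0D[p [c xE]]] := pselect (x = 0); first by rewrite msum0.
  by have := xk p; rewrite xE mset_memD => /(_ isT); lia.
have : exists a b : {mset P}, [/\ x = a + b, forall p, p \in a -> s p = - k.+1%:Z &
    forall p, p \in b -> - k%:Z <= s p < 0].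
  elim/mset_ind: x xk => [|p x IHx] xk.
    by exists 0, 0; rewrite addr0; split=> // p; rewrite in_mset0.
  have [|a [b [-> aE bE]]] := IHx; first by move=> q qx; apply: xk; rewrite in_msetDE qx orbT.
  have sp := xk p (mset_memD _ _).
  have [spk|spk] := eqVneq (s p) (- k.+1%:Z).
    exists ([mset p] + a), b; rewrite addrA; split=> // q.
    by rewrite in_msetDE in_mset1 => /orP[/eqP->//|/aE].
  exists a, ([mset p] + b); rewrite addrCA; split=> // q.
  rewrite in_msetDE in_mset1 => /orP[/eqP->|/bE//]; lia.
move=> [a [b [xE aE bE]]].
have sa y : (forall p, p \in y -> s p = - k.+1%:Z) -> sigma y = - (k.+1 * size y)%:Z.
  elim/mset_ind: y => [|p y IHy] yE; first by rewrite msum0 size_mset_zero muln0.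
  rewrite msumD msum1 size_msetD size_mset1 yE ?mset_memD // IHy; first by lia.
  by move=> q qy; apply: yE; rewrite in_msetDE qy orbT.
have [|//|[b1 [b2 [bb sb]]]|leb] := IH b.
- by move=> j /andP[j0 jk]; apply: dvdL; rewrite j0 leqW.
- left; exists b1, (a + b2); split=> //.
  by rewrite xE bb addrCA.
have /dvdnP[t Lt] : (k.+1 %| L)%N by apply: dvdL; rewrite leqnn.
have [/mset_take[a1 [a2 [a12 sa1]]]|lt_a] := leqP t (size a).
  left; exists a1, (a2 + b); rewrite xE a12 addrA; split=> //.
  rewrite sa ?sa1 1?mulnC -?Lt // => p pa1; apply: aE.
  by rewrite a12 in_msetDE pa1.
right; rewrite xE msumD (sa a aE) mulSn.
have : (k.+1 * size a < L)%N by rewrite Lt mulnC ltn_pmul2r.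
lia.
Qed.

(** The blocks are cut off one at a time; the margin [m * L] guarantees that a further one exists at
    every step. *)
Lemma blocks_exist m L t x : (0 < m)%N -> (forall j, (0 < j <= m)%N -> (j %| L)%N) ->
    (forall p, - m%:Z <= s p) -> nneg_count s x = 0%N ->
    sigma x <= - (L * t + m * L)%:Z ->
  exists y c, x = y + c /\ sigma c = - (L * t)%:Z.
Proof.
move=> m0 dvdL s_ge; elim: t x => [|t IH] x x0 sx.
  by exists x, 0; rewrite addr0 msum0 muln0.
have [|[b [x' [xE sb]]]|] := @block_exists L m x dvdL.
- by move=> p px; rewrite s_ge (nneg_count_eq0 x0 px).
- have [||y [c [x'E sc]]] := IH x'.
  + by move: x0; rewrite xE nneg_countD; lia.
  + by move: sx; rewrite xE msumD sb; lia.
  exists y, (b + c); rewrite xE x'E addrCA msumD sb sc; split=> //; lia.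
- by move: sx; lia.
Qed.

(* Replacing a nonnegative prime of an atom by a smaller one, and deleting negative
   primes to compensate, creates no new zero-sum parts: one of the two parts avoids
   the new prime, hence is already a part of the old atom. *)
Lemma zs_atom_shrink p q x v1 v2 : zs_atom s ([mset p] + x + (v1 + v2)) ->
  s p + sigma v2 = s q -> zs_atom s ([mset q] + x + v1).
Proof.
move=> [_ sX XI] spq; split.
- by rewrite -addrA; apply: mset1D_neq0.
- by move: sX; rewrite !msumD !msum1 -spq; lia.
have sX' : sigma ([mset q] + x + v1) = 0 by move: sX; rewrite !msumD !msum1 -spq; lia.
have key y c : x + v1 = y + c -> sigma y = 0 -> y = 0.
  move=> e sy; have [|//|] := XI y ([mset p] + c + v2) _ sy.
    have -> : [mset p] + x + (v1 + v2) = [mset p] + (x + v1) + v2 by rewrite !addrA.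
    by rewrite e [[mset p] + _]addrCA -addrA.
  by rewrite -addrA => /mset1D_neq0.
move=> y c; rewrite -addrA => e sy; case/mset1_refine: (e) => [[y' [yE]]|[c' [cE]]] e'.
  right; apply: (key c y'); first by rewrite e' addrC.
  by move: sX'; rewrite -addrA e msumD sy add0r.
by left; apply: key e' sy.
Qed.

End ZeroSumReplacement.

(** * Finitely many types of atoms, for classes bounded or unbounded above *)

Section Instances.
Variables (P A : choiceType) (s : P -> int) (ct : A -> {mset P}).
Hypothesis Hct : atom_param s ct.
Implicit Types (x y c : {mset P}) (p q : P) (z : {mset A}) (u : A).
Local Notation sigma := (msum s).
Local Notation cont := (msum ct).

Variable m : nat.
Hypothesis s_ge : forall p, - m%:Z <= s p.
Hypothesis m_gt0 : (0 < m)%N.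
Variable u0 : A.

Lemma rational_growth_finite : (forall p, s p <= m%:Z) -> rational_growth ct.
Proof.
move=> s_le; have [p0 _] : exists p : P, True.
  by have [p [c _]] := mset_neq0D (@ct_neq0 _ _ _ _ Hct u0); exists p.
(* One representative is chosen for each class; the default [p0] is never taken at a class that
   occurs. *)
pose rho (v : int) := xget p0 [set q | s q = v].
pose r p := rho (s p).
have sr p : s (r p) = s p.
  by rewrite /r /rho; case: xgetP => [q _ //|/(_ p) []].
apply: (@types_rational_growth _ _ s ct Hct (fun p => [mset r p])) => //.
- pose D := [set rho (n%:Z - m%:Z) | n in `I_(m.*2.+1)].
  apply: (@sub_finite_set _ _ [set x : {mset P} | (size x <= m.*2)%N /\ forall p, p \in x -> D p]).
    move=> _ [u _ <-] /=; split; last first.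
      move=> q /mem_msum[p [_ [_]]]; rewrite in_mset1 => /eqP->.
      exists (absz (s p + m%:Z)) => /=; first by have := s_ge p; have := s_le p; lia.
      by rewrite /r; congr rho; have := s_ge p; lia.
    have -> : size (msum (fun p => [mset r p]) (ct u) : {mset P}) = size (ct u).
      elim/mset_ind: (ct u) => [|p x IH]; first by rewrite msum0 !size_mset_zero.
      by rewrite msumD msum1 !size_msetD IH !size_mset1.
    have szx x : (size x <= nneg_count s x + nneg_count (fun p => - s p) x)%N.
      elim/mset_ind: x => [|p x IH]; first by rewrite size_mset_zero.
      by rewrite !nneg_countD !nneg_count1 size_msetD size_mset1;
        case: (leP 0 (s p)); case: (leP 0 (- s p)); lia.
    (* Lambert's bound for both signs limits the size of an atom to [2 m]. *)
    have /andP[_ h1] := nneg_count_ct Hct s_ge m_gt0 u.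
    have /andP[_ h2] : (0 < nneg_count (fun p => - s p) (ct u) <= m)%N.
      by apply: (nneg_count_ct (atom_param_opp Hct)) => // p; have := s_le p; lia.
    by apply: leq_trans (szx _) _; lia.
  exact/finite_msets/finite_image/finite_II.
- move=> u; have [p [c ->]] := mset_neq0D (@ct_neq0 _ _ _ _ Hct u).
  by rewrite msumD msum1; apply: mset1D_neq0.
- move=> u; have [_ ca cs] := Hct; have [u' e] := cs _ (zs_atom_relabel sr (ca u)).
  by exists u', 0; rewrite addr0 msum0.
(* Relabelling kills only the empty multiset, so there is nothing to absorb. *)
exists 1%N, 0%N; split=> // nu nu'.
have k0 x : msum (fun p => [mset r p]) x = 0 -> x = 0.
  have [->//|/mset_neq0D[p [c ->]]] := pselect (x = 0).
  by rewrite msumD msum1 => /mset1D_neq0.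
move=> /k0-> /k0-> _ n; exists 0, 0; rewrite msum0; split=> //.
by rewrite size_mset_zero.
Qed.

Lemma rational_growth_infinite q0 : s q0 < 0 -> (forall n : nat, exists p, n%:Z <= s p) ->
  rational_growth ct.
Proof.
move=> sq0 unbounded.
(* Every class from [- m] to -1 divides [L], and [B] is the margin needed to cut off blocks. *)
pose L := m`!; pose B := (m * L)%N.
have dvdL j : (0 < j <= m)%N -> (j %| L)%N by exact: dvdn_fact.
have L_gt0 : (0 < L)%N by exact: fact_gt0.
(* Absolute values below [B] are kept and larger ones recorded modulo [L]. The representative of a
   key has the least nonnegative class with that key; [q0] is a default for keys that do not
   occur. *)
pose key p := if (`|s p| < B)%N then `|s p|%N else (B + `|s p| %% L)%N.
have rhoP k : exists r, (exists p, 0 <= s p /\ key p = k) ->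
    [/\ 0 <= s r, key r = k & forall p, 0 <= s p -> key p = k -> s r <= s p].
  have [[p [sp kp]]|no] := pselect (exists p, 0 <= s p /\ key p = k); last by exists q0.
  have ex : exists n, `[< exists p, s p = n%:Z /\ key p = k >].
    by exists `|s p|%N; apply/asboolP; exists p; split=> //; lia.
  have [n /asboolP[r [sr kr]] nmin] := ex_minnP ex.
  exists r => _; rewrite sr kr; split=> // p' sp' kp'.
  have : (n <= `|s p'|)%N by apply: nmin; apply/asboolP; exists p'; split=> //; lia.
  by lia.
have [rho {}rhoP] := choice rhoP.
pose r p := rho (key p).
(* Replacement lowers the class by a multiple of [L]. If it really lowers it, the key is of the
   large kind, so the representative still has class at least [B]. *)
have rP p : 0 <= s p -> 0 <= s (r p) /\ exists t : nat, s p = s (r p) + (L * t)%:Z /\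
    ((0 < t)%N -> B%:Z <= s (r p)).
  move=> sp; have [|r0 kr /(_ p sp erefl) le] := rhoP (key p); first by exists p.
  split=> //; rewrite -/(r p) in r0 kr le *; move: kr; rewrite /key.
  case: ltnP => rB; case: ltnP => pB kr; try by lia.
    by exists 0%N; split=> //; lia.
  have : (`|s (r p)| = `|s p| %[mod L])%N by lia.
  move=> /eqP; rewrite eq_sym eqn_mod_dvd; last by lia.
  by move=> /dvdnP[t tE]; exists t; split; lia.
have key_lt p : (key p < B + L)%N.
  rewrite /key; case: (ltnP `|s p|%N B) => [h|_]; first exact: ltn_addr.
  by rewrite ltn_add2l ltn_pmod.
pose kappa p : {mset P} := if 0 <= s p then [mset r p] else 0.
have kappa_neg x : nneg_count s x = 0%N -> msum kappa x = 0.
  elim/mset_ind: x => [|p x IH]; first by rewrite msum0.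
  rewrite nneg_countD nneg_count1 msumD msum1 /kappa.
  by case: leP => sp h; [exfalso; lia | rewrite IH ?addr0].
have kappa_eq0 x : msum kappa x = 0 -> nneg_count s x = 0%N.
  elim/mset_ind: x => [|p x IH]; first by rewrite nneg_count0.
  rewrite nneg_countD nneg_count1 msumD msum1 /kappa.
  by case: leP => sp; [move/mset1D_neq0 | rewrite add0r => /IH->].
have size_kappa x : size (msum kappa x : {mset P}) = nneg_count s x.
  elim/mset_ind: x => [|p x IH]; first by rewrite msum0 nneg_count0 size_mset_zero.
  rewrite nneg_countD nneg_count1 msumD msum1 size_msetD IH /kappa.
  by case: leP => sp; rewrite ?size_mset1 ?size_mset_zero.
have kappa_ct_neq0 u : msum kappa (ct u) <> 0.
  by move=> /kappa_eq0 h; have := nneg_count_ct Hct s_ge m_gt0 u; rewrite h.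
(* The primes of [x] are replaced one by one: [acc] holds the representatives already inserted, and
   [v] the negative primes not yet deleted. *)
have lift (x acc v : {mset P}) : (forall p, p \in x -> 0 <= s p) ->
    (forall p, p \in acc -> 0 <= s p) -> nneg_count s v = 0%N ->
    zs_atom s (acc + x + v) ->
  exists nu, nneg_count s nu = 0%N /\ zs_atom s (acc + msum kappa x + nu).
  elim/mset_ind: x acc v => [|p x IH] acc v x0 acc0 v0 at0.
    by exists v; rewrite msum0.
  have sp : 0 <= s p by apply: x0; rewrite mset_memD.
  have [sr [t [spt tB]]] := rP p sp.
  have nn (y : {mset P}) : (forall p, p \in y -> 0 <= s p) -> 0 <= sigma y.
    elim/mset_ind: y => [|q y IHy] y0; first by rewrite msum0.
    rewrite msumD msum1; apply: addr_ge0; first by apply: y0; rewrite mset_memD.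
    by apply: IHy => q' q'y; apply: y0; rewrite in_msetDE q'y orbT.
  have x0' p' : p' \in x -> 0 <= s p' by move=> h; apply: x0; rewrite in_msetDE h orbT.
  have [v1 [v2 [vE sv2]]] : exists v1 v2, v = v1 + v2 /\ sigma v2 = - (L * t)%:Z.
    case: t => [|t] in spt tB *.
      by exists v, 0; rewrite addr0 msum0 muln0.
    (* The whole has sum 0 and the other primes of [acc] and [x] are nonnegative, so the sum of [v]
       is at most [- s p], which leaves the margin [B] beyond the blocks to be deleted. *)
    apply: (@blocks_exist _ s m) => //.
    case: at0 => _ + _; rewrite !msumD msum1.
    have := nn _ acc0; have := nn _ x0'; have := tB isT; rewrite -/B; lia.
  have at1 : zs_atom s ([mset r p] + (acc + x) + v1).
    apply: (@zs_atom_shrink _ _ p _ _ _ v2); last by rewrite sv2 spt; lia.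
    by rewrite -vE addrA [_ + acc]addrC -[acc + _ + x]addrA.
  have [||||nu [nu0 atnu]] := IH ([mset r p] + acc) v1 => //.
  - by move=> p'; rewrite in_msetDE in_mset1 => /orP[/eqP->|/acc0].
  - by move: v0; rewrite vE nneg_countD; lia.
  - by rewrite -[_ + acc + x]addrA.
  exists nu; split=> //.
  by rewrite msumD msum1 /kappa sp addrA [acc + _]addrC.
apply: (@types_rational_growth _ _ s ct Hct kappa) => //.
- apply: (@sub_finite_set _ _ [set x : {mset P} | (size x <= m)%N /\
     forall p, p \in x -> [set rho k | k in `I_(B + L)] p]).
    move=> _ [u _ <-] /=; split.
      by rewrite size_kappa; have /andP[] := nneg_count_ct Hct s_ge m_gt0 u.
    move=> q /mem_msum[p [_ [_]]]; rewrite /kappa; case: leP => sp; rewrite ?in_mset0 //.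
    by rewrite in_mset1 => /eqP->; exists (key p) => //; apply: key_lt.
  exact/finite_msets/finite_image/finite_II.
- move=> u; have [_ ca cs] := Hct; have [x [v [uE v0 _ xx _]]] := nneg_split s (ct u).
  have [||nu [nu0 at1]] := lift x 0 v xx _ v0.
  - by move=> p; rewrite in_mset0.
  - by rewrite add0r -uE.
  have [u' e] := cs _ at1; exists u', nu; rewrite (kappa_neg _ nu0); split=> //.
  by rewrite e add0r uE msumD (kappa_neg _ v0) addr0.
(* A large prime of class [s p], taken [- s q0] times, absorbs the discrepancy between
   the negative parts at the cost of at most [- s q0] atoms. *)
exists `|s q0|%N, `|s q0|%N; split; first by lia.
move=> nu nu' /kappa_eq0 nu0 /kappa_eq0 nu'0 snu n.
have [p sp] := unbounded (n * `|sigma nu|)%N.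
have snu0 := nneg_count0_le nu0.
(* By the choice of [p] the difference defining [c] is nonnegative, and [c] copies of [q0] bring the
   sum to 0. As [nu'] has the same sum as [nu], the same [f] completes both. *)
pose e := `|s q0|%N; pose c := absz (s p - (n * `|sigma nu|)%:Z).
pose f := [mset p] *+ e + [mset q0] *+ c.
have [|z' ez'] := @factorization_exists _ _ _ _ Hct (nu *+ (e * n) + f).
  rewrite /f !msumD !msumMn !msum1 !mulrn_posz.
  have -> : c%:Z = s p - (n * `|sigma nu|)%:Z by rewrite /c; lia.
  have -> : s q0 = - e%:Z by rewrite /e; lia.
  have -> : sigma nu = - `|sigma nu|%:Z by lia.
  by rewrite abszN absz_nat !PoszM; ring.
exists (nu' *+ (e * n) + f), z'; rewrite ez'; split; first by rewrite addrCA.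
(* The only nonnegative primes in this product are the [e] copies of [p], whatever [n] is. *)
have /andP[szz' _] := size_le_nneg_count Hct s_ge m_gt0 z'.
apply: leq_trans szz' _; rewrite ez' /f !nneg_countD.
have wMn x k : nneg_count s (x *+ k) = (nneg_count s x * k)%N.
  by elim: k => [|k IH]; rewrite ?muln0 ?nneg_count0 // mulrS nneg_countD IH mulnS.
rewrite !wMn nu0 !nneg_count1 [0 <= s q0]leNgt sq0 /= !mul0n addn0 add0n.
by case: (0 <= s p); rewrite /= ?mul1n ?mul0n.
Qed.

End Instances.

(** * Classes unbounded in both directions *)

Lemma mset_partition (K : choiceType) (Q : K -> Prop) (x : {mset K}) : exists y c : {mset K},
  [/\ x = y + c, forall p, p \in y -> Q p & forall p, p \in c -> ~ Q p].
Proof.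
elim/mset_ind: x => [|p x [y [c [-> yQ cQ]]]].
  by exists 0, 0; rewrite addr0; split=> // p; rewrite in_mset0.
have [Qp|nQp] := pselect (Q p).
  exists ([mset p] + y), c; rewrite addrA; split=> // q.
  by rewrite in_msetDE in_mset1 => /orP[/eqP->|/yQ].
exists y, ([mset p] + c); rewrite addrCA; split=> // q.
by rewrite in_msetDE in_mset1 => /orP[/eqP->|/cQ].
Qed.

Lemma mset1E (K : choiceType) (p q : K) : [mset p] q = (q == p).
Proof. by rewrite msetnE; case: eqP. Qed.

Lemma msum_count_le (A P : choiceType) (ct : A -> {mset P}) (z : {mset A}) p B :
  (forall u, u \in z -> (ct u p <= B)%N) -> (msum ct z p <= B * size z)%N.
Proof.
elim/mset_ind: z => [|u z IH] uB; first by rewrite msum0 mset_zeroE.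
rewrite msumD msum1 mset_addE size_msetD size_mset1 mulnDr muln1.
apply: leq_add; first by apply: uB; rewrite mset_memD.
by apply: IH => v vz; apply: uB; rewrite in_msetDE vz orbT.
Qed.

Lemma msum_count_eq0 (A P : choiceType) (ct : A -> {mset P}) (z : {mset A}) p :
  (forall u, u \in z -> ct u p = 0%N) -> msum ct z p = 0%N.
Proof.
move=> h; apply/eqP; rewrite -leqn0.
by apply: leq_trans (msum_count_le (B := 0%N) _) _ => // u /h->.
Qed.

Section Unbounded.
Variables (P A : choiceType) (s : P -> int) (ct : A -> {mset P}).
Hypothesis Hct : atom_param s ct.
Implicit Types (x y c : {mset P}) (p q : P) (z : {mset A}) (u : A).
Local Notation sigma := (msum s).
Local Notation cont := (msum ct).

(** The exponent [i] is the least positive one for which [|s b|] divides [i * |s a|]. The exponent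
    of [a] in a zero-sum part has the same divisibility, so it is 0 or [i]. *)
Lemma zs_atom_pair a b : 0 < s a -> s b < 0 -> exists i j : nat,
  [/\ (0 < i <= `|s b|)%N, (0 < j <= `|s a|)%N, (i * `|s a| = j * `|s b|)%N &
      zs_atom s ([mset a] *+ i + [mset b] *+ j)].
Proof.
move=> sa sb.
have ex : exists i, (0 < i)%N && (`|s b| %| i * `|s a|)%N.
  by exists `|s b|%N; rewrite dvdn_mulr // andbT; lia.
have [i /andP[i0 /dvdnP[j ij]] imin] := ex_minnP ex.
have ib : (i <= `|s b|)%N by apply: imin; rewrite dvdn_mulr // andbT; lia.
have j0 : (0 < j)%N.
  by rewrite lt0n; apply/eqP => j0; move: ij; rewrite j0 mul0n => /eqP; rewrite muln_eq0; lia.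
have ja : (j <= `|s a|)%N.
  have sb0 : (0 < `|s b|)%N by lia.
  have h : (j * `|s b| <= `|s a| * `|s b|)%N by rewrite -ij mulnC leq_mul2l ib orbT.
  by rewrite leq_pmul2r in h.
have nab : (a == b) = false by apply/eqP => ab; move: sa; rewrite ab; lia.
have sE k l : sigma ([mset a] *+ k + [mset b] *+ l) = (k * `|s a|)%:Z - (l * `|s b|)%:Z.
  by rewrite msumD !msumMn !msum1 !mulrn_posz; lia.
exists i, j; split=> //; rewrite ?i0 ?j0 //; split.
- move=> /(congr1 (fun x : {mset P} => x a)).
  by rewrite mset_addE !mset_MnE !mset1E eqxx nab mset_zeroE mul1n mul0n addn0 => i0';
    rewrite i0' in i0.
- by rewrite sE ij subrr.
have part y c : [mset a] *+ i + [mset b] *+ j = y + c ->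
    [/\ y = [mset a] *+ y a + [mset b] *+ y b, (y a <= i)%N & (y b <= j)%N].
  move=> e; have {}e p : (([mset a] *+ i + [mset b] *+ j)%R p = y p + c p)%N by rewrite e mset_addE.
  split.
  - apply: mset_ext => p; have := e p; rewrite !mset_addE !mset_MnE !mset1E.
    have [->|pa] := eqVneq p a; first by rewrite nab; lia.
    by have [->|pb] := eqVneq p b; lia.
  - by have := e a; rewrite !mset_addE !mset_MnE !mset1E eqxx nab; lia.
  - by have := e b; rewrite !mset_addE !mset_MnE !mset1E eqxx eq_sym nab; lia.
move=> y c e; have [yE ya yb] := part _ _ e.
rewrite [in sigma y]yE sE => sy.
have [ya0|ya0] := posnP (y a).
  left; rewrite yE ya0; suff -> : y b = 0%N by rewrite addr0.
  move: sy; rewrite ya0 mul0n => h; have : (y b * `|s b| == 0)%N by lia.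
  by rewrite muln_eq0 => /orP[/eqP->|]; lia.
have yai : y a = i.
  apply/eqP; rewrite eqn_leq ya /=; apply: imin; rewrite ya0 /=; apply/dvdnP; exists (y b); lia.
have ybj : y b = j.
  have sb0 : (0 < `|s b|)%N by lia.
  have : (y b * `|s b| == j * `|s b|)%N by rewrite -ij -yai; lia.
  by rewrite eqn_pmul2r // => /eqP.
right; apply: (@mset_addKl _ y); rewrite addr0 -e; rewrite [RHS]yE yai ybj //.
Qed.

Lemma unbounded_two_atoms : (forall n : nat, exists p, n%:Z <= s p) ->
    (forall n : nat, exists p, s p <= - n%:Z) ->
  exists w : A, forall N, exists u1 u2, [/\ w <> u1, w <> u2,
    exists z, cont ([mset w] + z) = cont ([mset u1] + [mset u2]) &
    forall z, cont z = cont ([mset u1] + [mset u2]) ->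
      z = [mset u1] + [mset u2] \/ (N <= size z)%N].
Proof.
move=> ubp ubn.
have [pe spe] := ubp 1%N; have [pf spf] := ubn 1%N.
have [||f' [e' [f'b e'b efE atw]]] := @zs_atom_pair pe pf; try lia.
have [_ _ cs] := Hct; have [w we] := cs _ atw.
pose e := `|s pe|%N; pose f := `|s pf|%N; rewrite -/e -/f in f'b e'b efE.
exists w => N.
(* Here [g] outweighs contributions of size [e * f] from fewer than [N] atoms, and [h] outweighs [f]
   copies of [pg] together with [f] copies of [pe]. *)
have [pg spg] := ubp (2 * (e * f) * N.+1)%N.+1; pose g := `|s pg|%N.
have [ph sph] := ubn (g * f + e * f)%N.+1; pose h := `|s ph|%N.
have [||al [be [alb beb abE at1]]] := @zs_atom_pair pg pf; try lia.
have [||ga [de [gab deb gdE at2]]] := @zs_atom_pair pe ph; try lia.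
rewrite -/e -/f -/g -/h in alb beb abE gab deb gdE.
have [u1 e1] := cs _ at1; have [u2 e2] := cs _ at2.
have h_gt : (g * f + e * f < h)%N by rewrite /h; lia.
have g_gt : (2 * (e * f) * N.+1 < g)%N by rewrite /g; lia.
have e_gt0 : (0 < e)%N by rewrite /e; lia.
have f_gt0 : (0 < f)%N by rewrite /f; lia.
have ef_gt0 : (0 < e * f)%N by rewrite muln_gt0 e_gt0.
have gef : (e * f < g)%N by have := @leq_pmulr (2 * (e * f)) N.+1 isT; lia.
have he : (e * f < h)%N by lia.
have fe : (e <= e * f)%N by rewrite leq_pmulr.
have ef : (f <= e * f)%N by rewrite leq_pmull.
have neq_ge : (pe == pg) = false by apply/eqP => eq; move: gef; rewrite /g -eq -/e; lia.
have neq_hf : (pf == ph) = false by apply/eqP => eq; move: he; rewrite /h -eq -/f; lia.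
have neq_ef : (pe == pf) = false by apply/eqP => eq; move: spf; rewrite -eq; lia.
have neq_eh : (pe == ph) = false by apply/eqP => eq; move: sph; rewrite -eq; lia.
have neq_gf : (pg == pf) = false by apply/eqP => eq; move: spf; rewrite -eq; lia.
have neq_gh : (pg == ph) = false by apply/eqP => eq; move: sph; rewrite -eq; lia.
have neqs := (neq_ge, neq_hf, neq_ef, neq_eh, neq_gf, neq_gh).
have neqs' : ((pg == pe = false) * (ph == pf = false) * (pf == pe = false) *
   (ph == pe = false) * (pf == pg = false) * (ph == pg = false))%type.
  by rewrite !(eq_sym pg) !(eq_sym ph pf) !(eq_sym pf pe)
    !(eq_sym ph pe) !(eq_sym ph pg) !(eq_sym pf pg) !neqs.
have cE : (forall p q k, ([mset p] *+ k)%R q = (q == p) * k)%N.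
  by move=> p q k; rewrite mset_MnE mset1E.
pose X : {mset P} := cont ([mset u1] + [mset u2]).
have XE p : X p = ((p == pg) * al + (p == pf) * be + ((p == pe) * ga + (p == ph) * de))%N.
  by rewrite /X msumD !msum1 e1 e2 !mset_addE !cE.
have partE x y : X = x + y ->
    x = [mset pg] *+ x pg + [mset pe] *+ x pe + [mset pf] *+ x pf + [mset ph] *+ x ph.
  move=> Xxy; apply: mset_ext => p; rewrite !mset_addE !cE.
  have := XE p; rewrite Xxy mset_addE.
  have [->|pg'] := eqVneq p pg; first by rewrite !(neqs, neqs', eqxx); clear; lia.
  have [->|pe'] := eqVneq p pe; first by rewrite !(neqs, neqs', eqxx); clear; lia.
  have [->|pf'] := eqVneq p pf; first by rewrite !(neqs, neqs', eqxx); clear; lia.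
  by have [->|ph'] := eqVneq p ph; clear; lia.
have sumE x y : X = x + y -> sigma x = 0 -> (g * x pg + e * x pe = f * x pf + h * x ph)%N.
  move=> /partE -> ; rewrite !msumD !msumMn !msum1 !mulrn_posz.
  rewrite !mset_addE !cE !(neqs, neqs', eqxx) /g /e /f /h; lia.
have wX (y : {mset P}) : (f' <= y pe)%N -> (e' <= y pf)%N -> exists d, y = ct w + d.
  move=> le1 le2; apply: mset_subD; apply/msubsetP => p.
  rewrite we mset_addE !cE.
  have [->|_] := eqVneq p pe; first by rewrite neq_ef; clear -le1; lia.
  by have [->|_] := eqVneq p pf; clear -le2; lia.
exists u1, u2; split.
- move=> wu; have := congr1 (fun u => ct u pe) wu.
  by rewrite we e1 !mset_addE !cE !(neqs, neqs', eqxx); lia.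
- move=> wu; have := congr1 (fun u => ct u pf) wu.
  by rewrite we e2 !mset_addE !cE !(neqs, neqs', eqxx); lia.
(* From [ga * e = de * h] and [h > e * f] follows [f' <= ga]; likewise [e' <= be]. So [w] divides
   the product. *)
- have [||d XwE] := wX X; rewrite ?XE ?(neqs, neqs', eqxx).
  + rewrite mul0n mul1n add0n !addn0 ?mul0n ?addn0.
    rewrite -(leq_pmul2r e_gt0) gdE.
    apply: (@leq_trans h); last by rewrite leq_pmull //; case/andP: deb.
    by apply: leq_trans (ltnW he); rewrite mulnC leq_pmul2l //; case/andP: f'b.
  + rewrite mul0n mul1n add0n !addn0 ?mul0n ?addn0.
    rewrite -(leq_pmul2r f_gt0) -abE.
    apply: (@leq_trans g); last by rewrite leq_pmull //; case/andP: alb.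
    by apply: leq_trans (ltnW gef); rewrite leq_pmul2r //; case/andP: e'b.
  have [|z ez] := @factorization_exists _ _ _ _ Hct d.
    by have := cont_sum0 Hct ([mset u1] + [mset u2]); rewrite -/X XwE msumD (ct_sum0 Hct) add0r.
  by exists z; rewrite -/X XwE msumD msum1 ez.
move=> z; rewrite -/X => ez; have [leN|ltN] := leqP N (size z); [by right|left].
(* A short factorization is split into the atoms [zI] containing [ph] and the atoms [zJ] without it;
   they will turn out to be [u2] and [u1]. *)
have [zI [zJ [zE zIP zJP]]] := mset_partition (fun u => (0 < ct u ph)%N) z.
have XIJ : X = cont zI + cont zJ by rewrite -ez zE msumD.
have uX u z' : z = [mset u] + z' -> X = ct u + cont z' by move=> zu; rewrite -ez zu msumD msum1.
have w_eq u : (f' <= ct u pe)%N -> (e' <= ct u pf)%N -> u = w.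
  move=> h1 h2; have [d uE] := wX (ct u) h1 h2; have [ci ca _] := Hct.
  have [_ _ uI] := ca u; have [/(ct_neq0 Hct)//|d0] := uI _ _ uE (ct_sum0 Hct w).
  by apply: ci; rewrite uE d0 addr0.
have uz u : u \in z ->
    [/\ (g * ct u pg + e * ct u pe = f * ct u pf + h * ct u ph)%N & (ct u pg <= al)%N].
  move=> /mset_inD[z' zu]; have Xu := uX _ _ zu; split; first by apply: sumE Xu (ct_sum0 Hct u).
  by have := XE pg; rewrite Xu mset_addE !(neqs, neqs', eqxx); clear; lia.
(* An atom containing [ph] is not [w], so with more than [e] copies of [pf] it has fewer than [f']
   copies of [pe]; its positive part is then at most [g * f + e * f], too small to balance [h]. *)
have leI : (cont zI pf <= e * size zI)%N.
  apply: msum_count_le => u uI; have uz' : u \in z by rewrite zE in_msetDE uI.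
  have [su ug] := uz u uz'; have uh := zIP u uI.
  rewrite leqNgt; apply/negP => lt_e.
  have lt_f : (ct u pe < f')%N.
    rewrite ltnNge; apply/negP => le_f; have uw := w_eq u le_f.
    move: uh; rewrite uw; last by clear -lt_e e'b; lia.
    by rewrite we mset_addE !cE !(neqs, neqs', eqxx).
  have h1 : (g * ct u pg <= g * f)%N.
    by rewrite leq_mul2l; apply/orP; right; clear -ug alb; lia.
  have h2 : (e * ct u pe <= e * f)%N.
    by rewrite leq_mul2l; apply/orP; right; clear -lt_f f'b; lia.
  have h3 : (h <= h * ct u ph)%N by rewrite leq_pmulr.
  by clear -su h1 h2 h3 h_gt; lia.
(* Without [ph], having [f'] copies of [pe] forces at least [e'] copies of [pf] by the balance of
   sums, and then the atom is [w]. *)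
have leJ : (cont zJ pe <= f * size zJ)%N.
  apply: msum_count_le => u uJ; have uz' : u \in z by rewrite zE in_msetDE uJ orbT.
  have [su ug] := uz u uz'; have uh : ct u ph = 0%N by have := zJP u uJ; clear; lia.
  have [lt_f|le_f] := ltnP (ct u pe) f'; first by clear -lt_f f'b; lia.
  have [lt_e|le_e] := ltnP (ct u pf) e'.
    have h1 : (f * ct u pf < f * e')%N by rewrite ltn_pmul2l.
    have h2 : (f' * e <= e * ct u pe)%N by rewrite mulnC leq_pmul2l.
    by move: su; rewrite uh muln0; clear -h1 h2 efE; lia.
  by rewrite (w_eq u le_f le_e) we mset_addE !cE !(neqs, neqs', eqxx); clear -f'b; lia.
have hJ0 : cont zJ ph = 0%N by apply: msum_count_eq0 => u /zJP; lia.
have XI p : X p = (cont zI p + cont zJ p)%N by rewrite XIJ mset_addE.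
have hI : cont zI ph = de.
  by have := XI ph; rewrite hJ0 XE !(neqs, neqs', eqxx); lia.
have eX : (cont zI pe + cont zJ pe)%N = ga by rewrite -XI XE !(neqs, neqs', eqxx); lia.
have sI := sumE _ _ XIJ (cont_sum0 Hct zI).
(* All copies of [ph] lie in [zI]; the balance of [zI] minus that of [u2] leaves this equation. Its
   right side is at most [e * f] times the length of [z], hence below [g], and both sides vanish. *)
have gI : (g * cont zI pg = e * cont zJ pe + f * cont zI pf)%N.
  have : (e * cont zI pe + e * cont zJ pe = h * de)%N by rewrite -mulnDr eX mulnC gdE mulnC.
  by move: sI; rewrite hI; lia.
have szN : (size zI + size zJ < N)%N by rewrite -size_msetD -zE.
have gI0 : cont zI pg = 0%N.
  apply/eqP; rewrite -leqn0 leqNgt; apply/negP => i0.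
  have h1 : (g <= g * cont zI pg)%N by rewrite leq_pmulr.
  have h2 : (e * cont zJ pe <= (e * f) * size zJ)%N by rewrite -mulnA leq_pmul2l.
  have h3 : (f * cont zI pf <= (e * f) * size zI)%N by rewrite [(e * f)%N]mulnC -mulnA leq_pmul2l.
  have h4 : ((e * f) * (size zI + size zJ) <= e * f * N.+1)%N by rewrite leq_pmul2l //; lia.
  by move: h4; rewrite mulnDr; lia.
have eJ0 : cont zJ pe = 0%N by move: gI; rewrite gI0 muln0; nia.
have fI0 : cont zI pf = 0%N by move: gI; rewrite gI0 muln0; nia.
have eI : cont zI pe = ga by rewrite -eX eJ0 addn0.
have czI : cont zI = ct u2.
  by rewrite (partE _ _ XIJ) e2 gI0 fI0 eI hI !mulr0n add0r addr0.
have czJ : cont zJ = ct u1.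
  by apply: (@mset_addKl _ (cont zI)); rewrite -XIJ czI /X msumD !msum1 addrC.
by rewrite zE (cont_atom Hct czI) (cont_atom Hct czJ) addrC.
Qed.

End Unbounded.

(** * From the monoid to zero-sum multisets *)

Section Bridge.
Local Open Scope quotient_scope.
Local Open Scope ring_scope.
Variables (H : cmonoidType) (P : choiceType) (phi : {additive H -> {mset P}}).
Variable (psi : {additive class_group phi -> int}).
Hypothesis phi_div : divisor_hom phi.
Hypothesis phi_cof : cofinal_hom phi.
Hypothesis psi_bij : bijective psi.
Implicit Types (a b : H) (r : reduced H) (x y : {mset P}).

Definition class_val (p : P) : int := psi (divisor_class phi [mset p]).

Definition content r : {mset P} := phi (repr r).

Definition atom_content (u : red_atom H) : {mset P} := content (val u).

Lemma phi_unit a : is_unit a -> phi a = 0.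
Proof. by move=> [b ab]; move: (congr1 phi ab); rewrite raddfD raddf0 => /mset_addr_eq0[]. Qed.

Lemma content_pi a : content (\pi_(reduced H) a) = phi a.
Proof.
rewrite /content; have := assoc_repr a => /asboolP[u uU ->].
by rewrite raddfD (phi_unit uU) addr0.
Qed.

Lemma pi_redD a b : \pi_(reduced H) (a + b) = \pi_(reduced H) a + \pi_(reduced H) b.
Proof. exact: pi_red_add. Qed.

Lemma contentD r1 r2 : content (r1 + r2) = content r1 + content r2.
Proof. by rewrite -[r1]reprK -[r2]reprK -pi_redD !content_pi raddfD. Qed.

Lemma content0 : content 0 = 0.
Proof. by apply: (@mset_addKl _ (content 0)); rewrite -contentD !addr0. Qed.

Lemma pi_phi a b : phi a = phi b -> \pi_(reduced H) a = \pi_(reduced H) b.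
Proof.
move=> e; have [|c bE] := @phi_div a b; first by exists 0; rewrite addr0.
apply/eqmodP/asboolP; exists c => //.
have [|d aE] := @phi_div b a; first by exists 0; rewrite addr0.
exists d; apply: (@cmon_addrI _ a); rewrite addr0.
by rewrite addrA -bE -aE.
Qed.

Lemma content_inj : injective content.
Proof. by move=> r1 r2; rewrite -[r1]reprK -[r2]reprK !content_pi => /pi_phi. Qed.

Lemma divisor_classD x y :
  divisor_class phi (x + y) = divisor_class phi x + divisor_class phi y.
Proof. by rewrite /divisor_class q_injD raddfD. Qed.

Lemma divisor_class0 : divisor_class phi 0 = 0.
Proof.
by apply: (@addrI _ (divisor_class phi 0)); rewrite -divisor_classD !addr0.
Qed.

Lemma class_valE x : msum class_val x = psi (divisor_class phi x).
Proof.
elim/mset_ind: x => [|p x IH]; first by rewrite msum0 divisor_class0 raddf0.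
by rewrite msumD msum1 IH divisor_classD raddfD.
Qed.

Lemma q_inj0 : q_inj (0 : {mset P}) = 0.
Proof. by apply: (@addrI _ (q_inj (0 : {mset P}))); rewrite -q_injD !addr0. Qed.

Lemma q_inj_eq x y x' y' : q_inj x - q_inj y = q_inj x' - q_inj y' -> x + y' = x' + y.
Proof.
move=> /eqP; rewrite subr_eq addrAC eq_sym subr_eq -!q_injD => /eqP.
by move=> /eqmodP/eqP /=; rewrite !addr0.
Qed.

Lemma class_val_phi a : msum class_val (phi a) = 0.
Proof.
rewrite class_valE -[RHS](raddf0 psi); congr (psi _).
rewrite /divisor_class -[RHS](raddf0 \pi_(Quotient.quot (q_image phi))).
apply/eqP; rewrite -Quotient.idealrBE subr0; apply/asboolP.
by exists a, 0; rewrite (raddf0 phi) q_inj0 subr0.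
Qed.

(** A multiset of trivial class satisfies [x + phi b = phi a]. Since [phi] is a divisor
    homomorphism, [b] divides [a] in [H], and the cofactor maps to [x]. *)
Lemma class_val_eq0 x : msum class_val x = 0 -> exists a, phi a = x.
Proof.
rewrite class_valE -[RHS](raddf0 psi) => /(bij_inj psi_bij).
rewrite /divisor_class -[RHS](raddf0 \pi_(Quotient.quot (q_image phi))).
move=> /eqP; rewrite -Quotient.idealrBE subr0 => /asboolP[a [b ab]].
have : q_inj x - q_inj 0 = q_inj (phi a) - q_inj (phi b).
  by rewrite -ab q_inj0 subr0.
move=> /q_inj_eq; rewrite addr0 => e.
have [|c aE] := @phi_div b a; first by exists x; rewrite -e addrC.
exists c; apply: (@mset_addKl _ (phi b)).
by rewrite -raddfD -aE -e addrC.
Qed.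

Lemma class_val_content r : msum class_val (content r) = 0.
Proof. exact: class_val_phi. Qed.

Lemma is_unit_red r : is_unit r <-> content r = 0.
Proof.
split=> [[r' e]|r0].
  by have := congr1 content e; rewrite contentD content0 => /mset_addr_eq0[].
exists 0; rewrite addr0; apply: content_inj; rewrite r0 content0 //.
Qed.

Lemma is_atom_red r : is_atom r <-> zs_atom class_val (content r).
Proof.
split=> [[nu ri]|[r0 _ ri]].
  split; [by move/is_unit_red | exact: class_val_content |].
  move=> y c e sy; have [a ay] := class_val_eq0 sy.
  have sc : msum class_val c = 0.
    by have := class_val_content r; rewrite e msumD sy add0r.
  have [b bc] := class_val_eq0 sc.
  have [||] := ri (\pi a) (\pi b); rewrite ?is_unit_red ?content_pi ?ay ?bc; auto.
  by apply: content_inj; rewrite contentD !content_pi ay bc.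
split=> [/is_unit_red//|a b rE].
by rewrite !is_unit_red; apply: ri; rewrite ?rE ?contentD // class_val_content.
Qed.

Lemma atom_content_param : atom_param class_val atom_content.
Proof.
split=> [u v /content_inj/val_inj//|u|x [x0 sx xI]].
  by apply/is_atom_red; have /asboolP := valP u.
have [a ax] := class_val_eq0 sx.
have at_a : is_atom (\pi_(reduced H) a).
  by apply/is_atom_red; rewrite content_pi ax.
have ata : `[< is_atom (\pi_(reduced H) a) >] by apply/asboolP.
by exists (exist (fun r => `[< is_atom r >]) _ ata); rewrite /atom_content /= content_pi.
Qed.

Lemma content_pi_fact (z : {mset red_atom H}) : content (pi_fact z) = msum atom_content z.
Proof.
have -> : pi_fact z = msum val z by [].
elim/mset_ind: z => [|u z IH]; first by rewrite !msum0 content0.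
by rewrite !msumD !msum1 contentD IH.
Qed.

Lemma Zset_content a z : Zset a z <-> msum atom_content z = phi a.
Proof.
rewrite /Zset /= -content_pi_fact; split=> [->|]; first exact: content_pi.
by rewrite -content_pi => /content_inj.
Qed.

(** By cofinality [p] divides some [phi a], whose sum is 0, so the cofactor contains a prime of
    negative class. *)
Lemma prime_class_pos p : 0 < class_val p -> exists q, class_val q < 0.
Proof.
move=> sp; have [a [c e]] := phi_cof [mset p].
have : msum class_val c < 0 by have := class_val_phi a; rewrite e msumD msum1; lia.
by move=> /msum_lt0_ex[q [_ [_ sq]]]; exists q.
Qed.

Lemma prime_class_neg p : class_val p < 0 -> exists q, 0 < class_val q.
Proof.
move=> sp; have [a [c e]] := phi_cof [mset p].
have : msum (fun q => - class_val q) c < 0.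
  by rewrite msum_opp; have := class_val_phi a; rewrite e msumD msum1; lia.
by move=> /msum_lt0_ex[q [_ [_ sq]]]; exists q; lia.
Qed.

(** With no primes the class group would be trivial and not infinite cyclic. By cofinality a
    nonempty multiset divides some [phi a], whose factorizations are then nonempty. *)
Lemma red_atom_exists : inhabited (red_atom H).
Proof.
have [u _] : exists u : red_atom H, True; last by [].
have [g _ psig] := psi_bij.
have [x0|/existsNP[x nx]] := pselect (forall x : {mset P}, x = 0).
  have : (1 : int) = 0; last by [].
  rewrite -(psig 1) -[RHS](raddf0 psi); congr (psi _).
  rewrite -[g 1]reprK -[repr (g 1)]reprK; case: (repr (repr (g 1))) => a b.
  rewrite (x0 a) (x0 b) -[RHS](raddf0 \pi_(Quotient.quot (q_image phi))).
  by congr (\pi _); exact: q_inj0.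
have [a [c e]] := phi_cof x.
have sx := class_val_phi a.
have [z ez] := factorization_exists atom_content_param sx.
have [z0|/mset_neq0D[u _]] := pselect (z = 0); last by exists u.
by move: ez; rewrite z0 msum0 e => /esym/mset_addr_eq0[].
Qed.

End Bridge.

(** * Unions of sets of lengths *)

Lemma min_natP (L : set nat) : L !=set0 -> L (min_nat L) /\ forall n, L n -> (min_nat L <= n)%N.
Proof.
move=> [n0 Ln0]; have ex : exists n, `[< L n >] by exists n0; apply/asboolP.
have [n /asboolP Ln nmin] := ex_minnP ex.
rewrite /min_nat; case: xgetP => [k _ [Lk lbk]|/(_ n)[]].
  by split=> // l /lbk.
by split=> // l Ll; apply: nmin; apply/asboolP.
Qed.

Lemma max_nat_ex (L : set nat) B : L !=set0 -> (forall n, L n -> (n <= B)%N) ->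
  exists2 n, L n & forall l, L l -> (l <= n)%N.
Proof.
move=> [n0 Ln0] LB; have ex : exists n, `[< L n >] by exists n0; apply/asboolP.
have [|n /asboolP Ln nmax] := @ex_maxnP (fun n => `[< L n >]) B ex.
  by move=> n /asboolP/LB.
by exists n => // l Ll; apply: nmax; apply/asboolP.
Qed.

Lemma adjacent_sym (L : set nat) k l : adjacent L k l -> adjacent L l k.
Proof.
move=> [Lk Ll kl e]; split=> //; first exact/nesym.
by rewrite minnC maxnC e setUC.
Qed.

Lemma adjacentP (L : set nat) k l : (k < l)%N ->
  adjacent L k l <-> [/\ L k, L l & forall x, L x -> ~ (k < x < l)%N].
Proof.
move=> kl; have mink : minn k l = k by lia.
have maxl : maxn k l = l by lia.
split=> [[Lk Ll _ e]|[Lk Ll noL]].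
  split=> // x Lx /andP[kx xl].
  have : (L `&` [set x | (minn k l <= x <= maxn k l)%N])%classic x.
    by split=> //=; rewrite mink maxl (ltnW kx) (ltnW xl).
  by rewrite e => -[]/= xE; lia.
split=> //; first by lia.
apply/seteqP; split=> [x [Lx /=]|x]; rewrite ?mink ?maxl.
  move=> /andP[kx xl]; have [xk|xk] := eqVneq x k; [by left|right].
  by apply/eqP/negP => /negP xnl; case: (noL x Lx); lia.
by move=> [->|->]; split=> //=; lia.
Qed.

Section UnionsOfLengths.
Variable H : cmonoidType.
Hypothesis LsetD : forall (a b : H) k l, Lset a k -> Lset b l -> Lset (a + b) (k + l)%N.
Hypothesis Lset0 : Lset (0 : H) 0%N.
Hypothesis Lset1 : exists a : H, Lset a 1%N.

Lemma V_P k l : V_ H k l <-> exists a : H, Lset a k /\ Lset a l.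
Proof. by split=> [[a ? ?]|[a [? ?]]]; exists a. Qed.

Lemma V_sym k l : V_ H k l -> V_ H l k.
Proof. by move=> /V_P[a [ak al]]; apply/V_P; exists a. Qed.

Lemma Lset_Mn (a : H) k n : Lset a k -> Lset (a *+ n) (n * k)%N.
Proof.
move=> ak; elim: n => [|n IH]; first by rewrite mul0n.
by rewrite mulrS mulSn; apply: LsetD.
Qed.

Lemma V_refl k : V_ H k k.
Proof.
have [a a1] := Lset1; apply/V_P; exists (a *+ k).
by have := Lset_Mn k a1; rewrite muln1.
Qed.

Lemma V_add k l k' l' : V_ H k l -> V_ H k' l' -> V_ H (k + k')%N (l + l')%N.
Proof.
by move=> /V_P[a [ak al]] /V_P[b [bk bl]]; apply/V_P; exists (a + b); split; apply: LsetD.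
Qed.

Lemma DeltaP n : Delta H n <->
  exists (a : H) k l, [/\ adjacent (Lset a) k l, (k < l)%N & l = (k + n)%N].
Proof.
split=> [[a _ [k [l [kl ->]]]]|[a [k [l [kl lt_kl lE]]]]]; last first.
  by exists a => //; exists k, l; split=> //; lia.
have [lt|lt|e] := ltngtP k l; last by case: kl.
- by exists a, k, l; split=> //; lia.
- by exists a, l, k; split=> //; [exact: adjacent_sym | lia].
Qed.

Lemma Delta_next (a : H) k l : Lset a k -> Lset a l -> (k < l)%N ->
  exists n, [/\ Delta H n, (0 < n)%N, Lset a (k + n)%N & (k + n <= l)%N].
Proof.
move=> ak al kl.
have ex : exists x, `[< Lset a x >] && (k < x)%N.
  by exists l; rewrite kl andbT; apply/asboolP.
have [l' /andP[/asboolP al' kl'] l'min] := ex_minnP ex.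
exists (l' - k)%N; rewrite subnKC ?(ltnW kl') //; split=> //; last first.
- by apply: l'min; rewrite kl andbT; apply/asboolP.
- by rewrite subn_gt0.
apply/DeltaP; exists a, k, l'; split=> //; last by lia.
apply/adjacentP => //; split=> // x ax /andP[kx xl'].
have : (l' <= x)%N by apply: l'min; rewrite kx andbT; apply/asboolP.
by lia.
Qed.

Section Growth.
Variables (p q C : nat).
Hypothesis q_gt0 : (0 < q)%N.
Hypothesis growth_le : forall k l, V_ H k l -> (l * q <= p * k)%N.
Hypothesis growth_ge : forall n, exists k l, [/\ V_ H k l, (p * n <= l)%N & (k <= q * n + C)%N].

Lemma V_max : exists r : nat -> nat, forall k, V_ H k (r k) /\ forall l, V_ H k l -> (l <= r k)%N.
Proof.
have /choice[r rP] k : exists n, V_ H k n /\ forall l, V_ H k l -> (l <= n)%N.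
  have [||n Vn nmax] := @max_nat_ex (V_ H k) (p * k); last by exists n.
    by exists k; apply: V_refl.
  by move=> n /growth_le le; apply: leq_trans le; rewrite leq_pmulr.
by exists r.
Qed.

Variable r : nat -> nat.
Hypothesis rP : forall k, V_ H k (r k) /\ forall l, V_ H k l -> (l <= r k)%N.

Lemma V_max_add k j : (r k + j <= r (k + j))%N.
Proof. by have [_] := rP (k + j)%N; apply; apply: V_add (rP k).1 (V_refl j). Qed.

Lemma V_max_homo k l : (k <= l)%N -> (r k <= r l)%N.
Proof. by move=> kl; have := V_max_add k (l - k); rewrite subnKC //; lia. Qed.

(** The two growth bounds keep [r k] within a constant of [p * k / q]. *)
Lemma V_max_increment k : (r k.+1 <= r k + p * (C + 2))%N.
Proof.
have h1 : (r k.+1 * q <= p * k.+1)%N by apply: growth_le; exact: (rP _).1.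
have [lekC|ltCk] := leqP k C.
  apply: leq_trans (leq_trans (leq_pmulr _ q_gt0) h1) _.
  by apply: leq_trans (leq_addl _ _); rewrite leq_mul2l; apply/orP; right; lia.
(* The largest [n] with [q * n + C <= k], which gives [p * n <= r k]. For [k <= C] the upper bound
   alone was enough. *)
pose n := ((k - C) %/ q)%N.
have nq : (n * q <= k - C)%N by rewrite leq_trunc_div.
have [k' [l [Vl ln k'n]]] := growth_ge n.
have pn_r : (p * n <= r k)%N.
  apply: leq_trans ln _; apply: leq_trans ((rP k').2 l Vl) _; apply: V_max_homo.
  by move: k'n; rewrite mulnC; lia.
have ltk : (k - C < n.+1 * q)%N by rewrite ltn_ceil.
have h2 : (p * k.+1 <= p * (n.+1 * q + C))%N by rewrite leq_mul2l; apply/orP; right; lia.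
have h3 : (p * (n.+1 * q + C) <= (p * n + p * (C + 1)) * q)%N.
  rewrite -mulnDr -mulnA leq_mul2l; apply/orP; right.
  have : (C <= C * q)%N by rewrite leq_pmulr.
  by rewrite !mulnDl; lia.
have : (r k.+1 <= p * n + p * (C + 1))%N.
  by rewrite -(leq_pmul2r q_gt0); apply: leq_trans h1 (leq_trans h2 h3).
by move: pn_r; rewrite !mulnDr; lia.
Qed.

Section Progression.
Variable N : nat.
Hypothesis Delta_le : forall n, Delta H n -> (n <= N)%N.
Hypothesis Delta0 : Delta H !=set0.

(** No positive difference of lengths is below [d]. If [d] did not divide [n], adding [n / d] copies
    of [b], with length [k0 + d] on the lower side and [k0] on the upper, would leave the smaller
    difference [n mod d]. *)
Lemma Delta_min : exists (b : H) k0, let d := min_nat (Delta H) in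
  [/\ (0 < d)%N, Lset b k0, Lset b (k0 + d)%N &
   forall k n, V_ H k (k + n)%N -> (d %| n)%N].
Proof.
have [/DeltaP[b [k0 [l0 [/adjacentP adj lt0 l0E]]]] dmin] := min_natP Delta0.
have [bk0 bl0 _] := adj lt0; set d := min_nat _ in l0E dmin *.
exists b, k0; split=> //; [by lia | by rewrite -l0E |].
have d_le k n : V_ H k (k + n)%N -> (0 < n)%N -> (d <= n)%N.
  move=> /V_P[a [ak al]] n0; have [|n' [/dmin le _ _ h]] := Delta_next ak al; first by lia.
  by lia.
move=> k n Vkn; rewrite /dvdn; apply/eqP.
have [//|n0] := posnP (n %% d)%N.
have d0 : (0 < d)%N by lia.
have := ltn_pmod n d0; suff : (d <= n %% d)%N by lia.
apply: (d_le (k + n %/ d * (k0 + d))%N) => //.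
have -> : (k + n %/ d * (k0 + d) + n %% d = (k + n) + n %/ d * k0)%N.
  by rewrite {3}(divn_eq n d) mulnDr; lia.
apply: V_add Vkn _; apply/V_P; exists (b *+ (n %/ d)).
by split; apply: Lset_Mn; rewrite -?l0E.
Qed.

Lemma Lset_dense (a : H) k l x : Lset a k -> Lset a l -> (k <= x <= l)%N ->
  exists2 y, Lset a y & (y <= x <= y + N)%N.
Proof.
move=> ak al /andP[kx xl].
have [||y [ay yx] ymax] := @max_nat_ex [set y | Lset a y /\ (y <= x)%N] x.
- by exists k.
- by move=> y [].
exists y => //; rewrite yx /= leqNgt; apply/negP => lt_x.
have [|n [/Delta_le nN n0 ayn _]] := Delta_next ay al; first by lia.
have [lex|] := leqP (y + n) x; last by lia.
by have := ymax (y + n)%N (conj ayn lex); lia.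
Qed.

(* A power of an element with lengths [k0] and [k0 + d] has enough consecutive
   multiples of [d] among its lengths to fill the gaps, bounded by [N], of any set
   of lengths. *)
Lemma V_upper : exists D, forall k i, (k + min_nat (Delta H) * i + D <= r k)%N ->
  V_ H k (k + min_nat (Delta H) * i)%N.
Proof.
have [b [k0 [d0 bk0 bl0 dvd_d]]] := Delta_min.
set d := min_nat _ in d0 bk0 bl0 dvd_d *.
pose e := (N * k0)%N; pose M := (p * (C + 2))%N.
have be j : (j <= N)%N -> Lset (b *+ N) (e + d * j)%N.
  move=> jN; rewrite -(subnKC jN) mulrnDr.
  have -> : (e + d * j = j * (k0 + d) + (N - j) * k0)%N.
    by rewrite /e -{1}(subnKC jN) mulnDl mulnDr [(d * j)%N]mulnC; lia.
  by apply: LsetD; apply: Lset_Mn.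
(* The term [e * M] pays for passing from [r k] to [r (k - e)]; the term [r e] excludes the case
   [k < e]. *)
exists (e * M + r e).+1 => k i le_r.
have [lt_ke|le_ek] := ltnP k e.
  by have := V_max_homo (ltnW lt_ke); lia.
pose k' := (k - e)%N; have kE : k = (k' + e)%N by rewrite /k' subnK.
have le_rk j : (r (k' + j) <= r k' + j * M)%N.
  elim: j => [|j IH]; first by rewrite addn0 mul0n addn0.
  by rewrite addnS; have := V_max_increment (k' + j); rewrite -/M mulSn; lia.
have /V_P[a [ak ar]] := (rP k').1.
have [|y ay /andP[yx xN]] := @Lset_dense a k' (r k') (k' + d * i) ak ar.
  by rewrite leq_addr /=; have := le_rk e; rewrite -kE; lia.
have /dvdnP[j jE] : (d %| k' + d * i - y)%N.
  have [ky|yk] := leqP k' y.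
    have : (d %| y - k')%N by apply: (dvd_d k'); apply/V_P; exists a; rewrite subnKC.
    have -> : (k' + d * i - y = d * i - (y - k'))%N by lia.
    by move=> h; apply: dvdn_sub => //; apply: dvdn_mulr.
  have : (d %| k' - y)%N.
    by apply: (dvd_d y); apply/V_P; exists a; rewrite subnKC // ltnW.
  have -> : (k' + d * i - y = d * i + (k' - y))%N by lia.
  by move=> h; apply: dvdn_add => //; apply: dvdn_mulr.
have jN : (j <= N)%N.
  apply: leq_trans (leq_pmulr j d0) _; rewrite -jE; lia.
apply/V_P; exists (a + b *+ N); split.
  by rewrite kE; apply: LsetD => //; have := be 0%N (leq0n _); rewrite muln0 addn0.
have -> : (k + d * i = y + (e + d * j))%N by rewrite [(d * j)%N]mulnC -jE; lia.
by apply: LsetD => //; apply: be.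
Qed.

(** [V_upper] describes the part above [k], and the symmetry of [V_ H k l] in [k] and [l] carries it
    over to the part below. Rounding to multiples of [d] costs less than [d], which the bound
    [D + d + 1] allows for. *)
Lemma V_AAP : exists M, (0 < M)%N /\ forall k, (0 < k)%N ->
  is_AAP (min_nat (Delta H)) M [set n%:Z | n in V_ H k].
Proof.
have [b [k0 [d0 bk0 bl0 dvd_d]]] := Delta_min.
have [D Dup] := V_upper.
set d := min_nat _ in d0 bk0 bl0 dvd_d Dup *.
exists (D + d).+1; split=> // k _.
have [l Vl lmin] : exists2 l, V_ H k l & forall l', V_ H k l' -> (l <= l')%N.
  have ne : V_ H k !=set0 by exists k; apply: V_refl.
  by have [? ?] := min_natP ne; exists (min_nat (V_ H k)).
have lk : (l <= k)%N by apply/lmin/V_refl.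
have kr : (k <= r k)%N by apply: (rP k).2; apply: V_refl.
(* With [x = k - d * i] the claim is that [k] lies in [V_ H x]. It holds because [r l >= k] and
   [x - l >= D] give [r x >= k + D]. *)
have Dlow i : (l + D + d * i <= k)%N -> V_ H k (k - d * i)%N.
  move=> le_k; apply: V_sym; set x := (k - d * i)%N.
  have -> : k = (x + d * i)%N by rewrite /x subnK //; lia.
  apply: Dup; have := (rP l).2 k (V_sym Vl); have := V_max_add l (x - l).
  by rewrite subnKC /x; lia.
(* The numbers of steps [d] below and above [k] that keep a distance [D] from both ends. Truncated
   subtraction gives 0 if there is no room, and then [k] itself is the end of the progression on
   that side. *)
pose iL := ((k - (l + D)) %/ d)%N; pose iH := ((r k - D - k) %/ d)%N.
have iLle : (iL * d <= k - (l + D))%N by rewrite leq_trunc_div.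
have iLge : (k - (l + D) < iL * d + d)%N by rewrite -mulSnr ltn_ceil.
have iHle : (iH * d <= r k - D - k)%N by rewrite leq_trunc_div.
have iHge : (r k - D - k < iH * d + d)%N by rewrite -mulSnr ltn_ceil.
pose lo := (k - iL * d)%N.
have loE : (lo + iL * d = k)%N by rewrite /lo subnK //; lia.
have Vdvd x : V_ H k x -> exists j : int, x%:Z = lo%:Z + d%:Z * j.
  move=> Vx; have [kx|xk] := leqP k x.
    have /dvdnP[j jE] : (d %| x - k)%N by apply: (dvd_d k); rewrite subnKC.
    by exists (j + iL)%:Z; rewrite -loE in jE *; nia.
  have /dvdnP[j jE] : (d %| k - x)%N.
    by apply: (dvd_d x); rewrite subnKC ?(ltnW xk) //; exact: V_sym.
  by exists (iL%:Z - j%:Z); nia.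
split=> //; pose m := d%:Z * (iL + iH)%:Z.
exists lo%:Z, m, [set x | x < 0 /\ exists2 n, V_ H k n & n%:Z = lo%:Z + x],
  ([set d%:Z * x | x in [set: int]] `&` [set x | 0 <= x <= m])%classic,
  [set x | m < x /\ exists2 n, V_ H k n & n%:Z = lo%:Z + x].
have m0 : 0 <= m by rewrite /m; nia.
split; [|move=> _ [n Vn <-]| |].
- apply/seteqP; split=> [_ [n Vn <-]|_ [x [[|]|] + <-]] /=.
  + have [j nE] := Vdvd n Vn; exists (n%:Z - lo%:Z); last by lia.
    have [lt0|ge0] := ltP (n%:Z - lo%:Z) 0; first by left; left; split=> //; exists n => //; lia.
    have [le_m|lt_m] := leP (n%:Z - lo%:Z) m.
      by left; right; split; [exists j => //; lia | apply/andP].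
    by right; split=> //; exists n => //; lia.
  + by move=> [_ [n Vn nE]]; exists n.
  + move=> [[j _ jE] /andP[x0 xm]].
    have j0 : 0 <= j by rewrite -jE in x0; nia.
    have jm : j <= (iL + iH)%:Z by rewrite -jE /m in xm; nia.
    exists (lo + d * `|j|)%N; last by rewrite -jE; lia.
    have loE' : (lo + d * iL = k)%N by rewrite [(d * iL)%N]mulnC.
    have [le_jL|lt_jL] := leqP `|j|%N iL.
      have le1 : (d * `|j| <= d * iL)%N by rewrite leq_mul2l le_jL orbT.
      have -> : (lo + d * `|j| = k - d * (iL - `|j|))%N by rewrite mulnBr; lia.
      have [->|ne] := eqVneq `|j|%N iL; first by rewrite subnn muln0 subn0; apply: V_refl.
      apply: Dlow; have iL0 : (0 < iL * d)%N by rewrite muln_gt0 d0 andbT; lia.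
      have : (d * (iL - `|j|) <= iL * d)%N by rewrite [leqRHS]mulnC leq_mul2l leq_subr orbT.
      by lia.
    have le1 : (d * iL <= d * `|j|)%N by rewrite leq_mul2l (ltnW lt_jL) orbT.
    have -> : (lo + d * `|j| = k + d * (`|j| - iL))%N by rewrite mulnBr; lia.
    apply: Dup; have le2 : (`|j| - iL <= iH)%N by lia.
    have : (d * (`|j| - iL) <= iH * d)%N by rewrite [leqRHS]mulnC leq_mul2l le2 orbT.
    have iH0 : (0 < iH * d)%N by rewrite muln_gt0 d0 andbT; lia.
    by lia.
  + by move=> [_ [n Vn nE]]; exists n.
- by have [j ->] := Vdvd n Vn; exists j.
- apply: (@sub_finite_set _ _ [set n%:Z | n in `I_(`|m|.+1)]); last exact/finite_image/finite_II.
  by move=> x [_ /= /andP[x0 xm]]; exists `|x|%N => /=; lia.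
split.
- by split; [split; [exists 0; rewrite ?mulr0 | apply/andP; split] | move=> x [_ /= /andP[]]].
- by split; [split; [exists (iL + iH)%:Z | apply/andP; split] | move=> x [_ /= /andP[]]].
- by [].
- move=> x [/= x0 [n Vn nE]]; have := lmin n Vn; lia.
- by move=> x [/= xm [n Vn nE]]; have := (rP k).2 n Vn; move: xm; rewrite /m; nia.
Qed.

End Progression.
End Growth.
End UnionsOfLengths.

(** * The invariants *)

Section ExtendedReals.
Variable R : realType.
Local Open Scope ereal_scope.

Lemma ereal_lt_nat (x : \bar R) : x < +oo -> exists N : nat, x < N%:R%:E.
Proof.
case: x => [x _|//|_]; last by exists 0%N; rewrite ltNyr.
by exists (Num.trunc x).+1; rewrite lte_fin; apply: truncnS_gt.
Qed.

Lemma sup_nat_le (L : set nat) (x : \bar R) :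
  (forall n, L n -> n%:R%:E <= x) -> sup_nat R L <= x.
Proof. by move=> h; apply/ereal_supP => _ [n Ln <-]; apply: h. Qed.

Lemma sup_nat_ge (L : set nat) n : L n -> n%:R%:E <= sup_nat R L.
Proof. by move=> Ln; apply: ereal_sup_ubound; exists n. Qed.

Lemma sup_nat_max (L : set nat) n : L n -> (forall l, L l -> (l <= n)%N) ->
  sup_nat R L = n%:R%:E.
Proof.
move=> Ln nmax; apply/eqP; rewrite eq_le sup_nat_ge // andbT.
by apply: sup_nat_le => l /nmax le; rewrite lee_fin ler_nat.
Qed.

Lemma sup_inf_nat_lt (I : Type) (S : I -> set nat) :
  (exists N, forall a, S a N) -> ereal_sup [set inf_nat R (S a) | a in [set: I]] < +oo.
Proof.
move=> [N SN]; apply: (@le_lt_trans _ _ N%:R%:E); last by rewrite ltry.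
apply/ereal_supP => _ [a _ <-]; apply: ereal_inf_lbound; exists N => //.
Qed.

Lemma sup_inf_nat_bounded (I : Type) (S : I -> set nat) :
  ereal_sup [set inf_nat R (S a) | a in [set: I]] < +oo ->
  exists N, forall a, exists2 n, S a n & (n <= N)%N.
Proof.
move=> /ereal_lt_nat[N ltN]; exists N => a.
have : inf_nat R (S a) < N%:R%:E.
  by apply: le_lt_trans ltN; apply: ereal_sup_ubound; exists a.
move=> /ereal_inf_lt[_ [n San <-]]; rewrite lte_fin ltr_nat => /ltnW.
by exists n.
Qed.

End ExtendedReals.

Section Invariants.
Variables (R : realType) (H : cmonoidType) (P : choiceType) (phi : {additive H -> {mset P}}).
Variables (s : P -> int) (ct : red_atom H -> {mset P}) (u0 : red_atom H).
Hypothesis Hct : atom_param s ct.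
Hypothesis ZsetE : forall a z, Zset a z <-> msum ct z = phi a.
Hypothesis phi_onto : forall x, msum s x = 0 -> exists a, phi a = x.
Local Notation cont := (msum ct).

Lemma phi_cont z : exists a, phi a = cont z.
Proof. exact/phi_onto/(cont_sum0 Hct). Qed.

Lemma V_cont z z' : cont z = cont z' -> V_ H (size z) (size z').
Proof.
move=> e; have [a az] := phi_cont z; apply/V_P; exists a.
by split; [exists z | exists z'] => //; apply/ZsetE; rewrite -?e az.
Qed.

Lemma V_contP k l : V_ H k l -> exists z z', [/\ cont z = cont z', size z = k & size z' = l].
Proof.
move=> /V_P[a [[z /ZsetE az <-] [z' /ZsetE az' <-]]].
by exists z, z'; rewrite az az'.
Qed.

Hypothesis phi_sum0 : forall a, msum s (phi a) = 0.

Lemma Lset_neq0 (a : H) : Lset a !=set0.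
Proof.
have [z ez] := factorization_exists Hct (phi_sum0 a).
by exists (size z); exists z => //; apply/ZsetE.
Qed.

Lemma LsetD (a b : H) k l : Lset a k -> Lset b l -> Lset (a + b) (k + l)%N.
Proof.
move=> [z /ZsetE az <-] [z' /ZsetE bz' <-]; exists (z + z'); last exact: size_msetD.
by apply/ZsetE; rewrite msumD az bz' raddfD.
Qed.

Lemma Lset00 : Lset (0 : H) 0%N.
Proof.
by exists 0; rewrite ?size_mset_zero //; apply/ZsetE; rewrite msum0 raddf0.
Qed.

Lemma Lset1 : exists a : H, Lset a 1%N.
Proof.
have [a au] := phi_cont [mset u0]; exists a; exists [mset u0]; last exact: size_mset1.
by apply/ZsetE; rewrite au.
Qed.

Lemma V1 l : V_ H 1 l -> l = 1%N.
Proof.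
move=> /V_contP[z [z' [e z1 <-]]].
have [p [c zE]] : exists p c, z = [mset p] + c.
  by apply: mset_neq0D => z0; move: z1; rewrite z0 size_mset_zero.
have c0 : c = 0.
  by apply: size_mset_eq0P; move: z1; rewrite zE size_msetD size_mset1; lia.
by rewrite (cont_atom Hct (z := z') (u := p)) ?size_mset1 // -e zE c0 addr0 msum1.
Qed.

Lemma Lset_gt0 (a : H) k : Lset a k -> (0 < k)%N -> (0 < min_nat (Lset a))%N.
Proof.
move=> [z /ZsetE az <-] k0; have [[z' /ZsetE az' <-] _] := min_natP (Lset_neq0 a).
rewrite lt0n; apply/eqP => /size_mset_eq0P z'0.
have z0 : z = 0 by apply: (cont_eq0 Hct); rewrite az -az' z'0 msum0.
by move: k0; rewrite z0 size_mset_zero.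
Qed.

Lemma elasticity_ge k l : V_ H k l -> (0 < k)%N ->
  ((l%:R / k%:R)%:E <= elasticity R H)%E.
Proof.
move=> /V_P[a [ak al]] k0.
have m0 := Lset_gt0 ak k0; have [Lm mmin] := min_natP (Lset_neq0 a).
apply: (@le_trans _ _ (set_elasticity R (Lset a))); last by apply: ereal_sup_ubound; exists a.
rewrite /set_elasticity; case: asboolP => [L0|_].
  by move: ak; rewrite L0 /= => k00; rewrite k00 in k0.
apply: (@le_trans _ _ (l%:R%:E * ((min_nat (Lset a))%:R^-1)%:E)%E); last first.
  by apply: lee_wpmul2r; rewrite ?lee_fin ?invr_ge0 //; apply: sup_nat_ge.
rewrite -EFinM lee_fin; apply: ler_wpM2l => //.
by rewrite lef_pV2 ?posrE ?ltr0n // ler_nat; apply: mmin.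
Qed.

(** The elasticity is at most [p / q], and the ratios [p * n / (q * n + C)] tend to this value. *)
Lemma elasticity_rational : rational_growth ct -> exists q : rat, elasticity R H = (ratr q)%:E.
Proof.
move=> [p [q [C [q0 le_pq ge_pq]]]].
have V_le k l : V_ H k l -> (l * q <= p * k)%N.
  by move=> /V_contP[z [z' [e <- <-]]]; apply: le_pq.
have qR : (0 : R) < q%:R by rewrite ltr0n.
have qp : (q <= p)%N.
  by have := V_le _ _ (V_refl LsetD Lset00 Lset1 1); rewrite mul1n muln1.
exists (p%:R / q%:R); rewrite fmorph_div !rmorph_nat; apply/eqP; rewrite eq_le; apply/andP; split.
  apply/ereal_supP => _ [a _ <-]; rewrite /set_elasticity; case: asboolP => [_|Ln0].
    by rewrite lee_fin ler_pdivlMr // mul1r ler_nat.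
  have [Lm mmin] := min_natP (Lset_neq0 a).
  have m0 : (0 < min_nat (Lset a))%N.
    rewrite lt0n; apply/eqP => m0; apply: Ln0; apply/seteqP; split=> [k ak /=|_ ->];
      last by rewrite -m0.
    by have [//|k0] := posnP k; have := Lset_gt0 ak k0; rewrite m0.
  have mR : (0 : R) < (min_nat (Lset a))%:R by rewrite ltr0n.
  apply: (@le_trans _ _ ((p%:R / q%:R * (min_nat (Lset a))%:R)%:E *
    ((min_nat (Lset a))%:R^-1)%:E)%E); last first.
    by rewrite -EFinM mulfK ?lt0r_neq0.
  apply: lee_wpmul2r; first by rewrite lee_fin invr_ge0 ltW.
  apply: sup_nat_le => l al; rewrite lee_fin mulrAC ler_pdivlMr // -!natrM ler_nat.
  by apply: V_le; apply/V_P; exists a.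
have p0 : (0 < p)%N by apply: leq_trans q0 qp.
have gen n : (0 < n)%N -> (((p * n)%:R / (q * n + C)%:R)%:E <= elasticity R H)%E.
  move=> n0; have [z [z' [e lz z'l]]] := ge_pq n.
  have z0 : (0 < size z)%N by apply: leq_trans lz; rewrite muln_gt0 p0.
  have z'0 : (0 < size z')%N.
    have := le_pq _ _ e; rewrite lt0n; case: eqP => // ->; rewrite muln0 leqn0 muln_eq0.
    by case/orP=> /eqP h; [move: z0; rewrite h | move: q0; rewrite h].
  apply: le_trans (elasticity_ge (V_cont (esym e)) z'0); rewrite lee_fin.
  apply: (@le_trans _ _ ((p * n)%:R / (size z')%:R)).
    by apply: ler_wpM2l => //; rewrite lef_pV2 ?posrE ?ltr0n ?(leq_trans z'0) // ler_nat.
  by apply: ler_wpM2r; rewrite ?invr_ge0 // ler_nat.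
rewrite leNgt; apply/negP; case: (elasticity R H) gen => [r|_ |].
- move=> gen; rewrite lte_fin ltr_pdivlMr // => rq.
  (* Chosen so that [n * (p - r * q) > r * C], which contradicts [p * n <= r * (q * n + C)]. *)
  pose n := (Num.trunc (r * C%:R / (p%:R - r * q%:R))).+1.
  have pr : 0 < p%:R - r * q%:R by rewrite subr_gt0.
  have := gen n isT; rewrite lee_fin ler_pdivrMr ?ltr0n; last first.
    by rewrite addn_gt0 muln_gt0 q0.
  have : r * C%:R / (p%:R - r * q%:R) < n%:R by apply: truncnS_gt.
  rewrite ltr_pdivrMr // natrD !natrM => h1 h2.
  suff : r * C%:R < r * C%:R by rewrite ltxx.
  apply: lt_le_trans h1 _; rewrite mulrBr lerBlDr [n%:R * p%:R]mulrC.
  by apply: le_trans h2 _; rewrite le_eqVlt; apply/orP; left; apply/eqP; ring.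
- by rewrite ltNge leey.
- by move=> /(_ 1%N isT).
Qed.

Lemma tame_degree_finite u : (exists N, forall y z, cont z = ct u + y ->
    exists z', cont ([mset u] + z') = ct u + y /\ (fm_dist z ([mset u] + z')%R <= N)%N) ->
  (tame_degree R u < +oo)%E.
Proof.
move=> [N hN]; apply: sup_inf_nat_lt; exists N => a [z0 [/ZsetE az0 [c z0E]]] z /ZsetE az.
have [|z' [e d]] := hN (cont c) z; first by rewrite az -az0 z0E msumD msum1.
exists ([mset u] + z') => //; split; last by exists z'.
by apply/ZsetE; rewrite e -az0 z0E msumD msum1.
Qed.

Lemma catenary_degree_finite : (exists N, forall z z', cont z = cont z' -> chain ct N z z') ->
  (catenary_degree R H < +oo)%E.
Proof.
move=> [N hN]; apply: sup_inf_nat_lt; exists N => a z z' /ZsetE az /ZsetE az'.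
have [|r [rz pr lr]] := hN z z'; first by rewrite az az'.
by exists r; split=> // y yr; apply/ZsetE; rewrite rz.
Qed.

(** Along a chain, lengths change by at most the distance of a step, and a chain between
    factorizations of adjacent lengths has to cross the gap in a single step. *)
Lemma catenary_degree_Delta : (catenary_degree R H < +oo)%E ->
  exists N, forall n, Delta H n -> (n <= N)%N.
Proof.
move=> /sup_inf_nat_bounded[N hN]; exists N => n.
move=> /DeltaP[a [k [l [/adjacentP adj lt_kl lE]]]].
have [[z az zk] [z' az' z'l] nomid] := adj lt_kl.
have [m cm mN] := hN a; have [r [ra pr lr]] := cm z z' az az'.
suff : (l <= k + m)%N by lia.
have zk' : (size z <= k)%N by rewrite zk.
elim: r z {az zk} zk' ra pr lr => [|y r IH] z zk ra /=.
  by move=> _ zz'; move: zk; rewrite zz' z'l; lia.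
move=> /andP[dzy pr] lr; have ay : Zset a y by apply: ra; rewrite inE eqxx.
have [yk|ky] := leqP (size y) k.
  by apply: (IH y) => // t tr; apply: ra; rewrite inE tr orbT.
have ly : (l <= size y)%N.
  by rewrite leqNgt; apply/negP => yl; apply: (nomid (size y)); [exists y | rewrite ky].
by have := fm_dist_ge z y; lia.
Qed.

Lemma rho_V_max (r : nat -> nat) : (forall k, V_ H k (r k) /\ forall l, V_ H k l -> (l <= r k)%N) ->
  forall k, rho_ R H k = (r k)%:R%:E.
Proof. by move=> rP k; have [? ?] := rP k; apply: sup_nat_max. Qed.

Section Growth.
Hypothesis growth : rational_growth ct.

Lemma V_growth : exists p q C : nat, [/\ (0 < q)%N,
  forall k l, V_ H k l -> (l * q <= p * k)%N &
  forall n, exists k l, [/\ V_ H k l, (p * n <= l)%N & (k <= q * n + C)%N]].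
Proof.
have [p [q [C [q0 le_pq ge_pq]]]] := growth; exists p, q, C; split=> //.
  by move=> k l /V_contP[z [z' [e <- <-]]]; apply: le_pq.
move=> n; have [z [z' [e lz z'l]]] := ge_pq n.
by exists (size z'), (size z); split=> //; apply: V_cont.
Qed.

Lemma rho2_finite : (rho_ R H 2 < +oo)%E.
Proof.
have [p [q [C [q0 Vle Vge]]]] := V_growth.
have [r rP] := V_max LsetD Lset00 Lset1 q0 Vle.
by rewrite (rho_V_max rP) ltry.
Qed.

Lemma rho_increments : exists M : nat, (0 < M)%N /\
  forall k, (0 < k)%N -> (rho_ R H k.+1 - rho_ R H k <= M%:R%:E)%E.
Proof.
have [p [q [C [q0 Vle Vge]]]] := V_growth.
have [r rP] := V_max LsetD Lset00 Lset1 q0 Vle.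
exists (p * (C + 2)).+1; split=> // k _; rewrite !(rho_V_max rP) -EFinB lee_fin.
rewrite lerBlDr -natrD ler_nat.
have := V_max_increment LsetD Lset00 Lset1 q0 Vle Vge rP k; lia.
Qed.

Lemma V_AAP_all N : (forall n, Delta H n -> (n <= N)%N) ->
  Delta H = set0 \/ exists M : nat, (0 < M)%N /\
    forall k, (0 < k)%N -> is_AAP (min_nat (Delta H)) M [set n%:Z%R | n in V_ H k].
Proof.
move=> DN; have [D0|/eqP/set0P D0] := pselect (Delta H = set0); [by left|right].
have [p [q [C [q0 Vle Vge]]]] := V_growth.
have [r rP] := V_max LsetD Lset00 Lset1 q0 Vle.
exact: (V_AAP LsetD Lset00 Lset1 q0 Vle Vge rP DN D0).
Qed.

End Growth.

Section Unbounded.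
Hypothesis s_unbounded_pos : forall n : nat, exists p, n%:Z <= s p.
Hypothesis s_unbounded_neg : forall n : nat, exists p, s p <= - n%:Z.

Lemma two_atom_elements : exists w : red_atom H, forall N, exists a u1 u2 z,
  [/\ Zset a ([mset u1] + [mset u2]), Zset a ([mset w] + z), w <> u1 /\ w <> u2 &
    forall y, Zset a y -> y = [mset u1] + [mset u2] \/ (N <= size y)%N].
Proof.
have [w wP] := unbounded_two_atoms Hct s_unbounded_pos s_unbounded_neg.
exists w => N; have [u1 [u2 [n1 n2 [z ez] zP]]] := wP N.
have [a au] := phi_cont ([mset u1] + [mset u2]); exists a, u1, u2, z.
split=> //; [exact/ZsetE | by apply/ZsetE; rewrite au |].
by move=> y /ZsetE ay; apply: zP; rewrite ay au.
Qed.

Lemma with_atom_long (w : red_atom H) N (a : H) u1 u2 (z : {mset red_atom H}) :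
    w <> u1 /\ w <> u2 ->
    (forall y, Zset a y -> y = [mset u1] + [mset u2] \/ (N <= size y)%N) ->
  Zset a ([mset w] + z) -> (N <= size (([mset w] + z)%R : {mset red_atom H}))%N.
Proof.
move=> [n1 n2] aP /aP[e|//]; have : w \in [mset u1] + [mset u2] by rewrite -e mset_memD.
by rewrite in_msetDE !in_mset1 => /orP[] /eqP.
Qed.

Lemma size_pair (A : choiceType) (u1 u2 : A) : size (([mset u1] + [mset u2]) : {mset A}) = 2%N.
Proof. by rewrite size_msetD !size_mset1. Qed.

Lemma two_lengths N : exists (a : H) l, [/\ Lset a 2%N, Lset a l, (N <= l)%N &
  forall k, Lset a k -> k = 2%N \/ (N <= k)%N].
Proof.
have [w wP] := two_atom_elements; have [a [u1 [u2 [z [az1 az2 nw aP]]]]] := wP N.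
exists a, (size ([mset w] + z : {mset red_atom H})); split.
- by exists ([mset u1] + [mset u2]) => //; rewrite size_pair.
- by exists ([mset w] + z).
- exact: with_atom_long nw aP az2.
- by move=> _ [y /aP[->|?] <-]; [left; rewrite size_pair | right].
Qed.

Lemma V2_unbounded N : exists2 l, V_ H 2 l & (N <= l)%N.
Proof.
by have [a [l [a2 al Nl _]]] := two_lengths N; exists l => //; apply/V_P; exists a.
Qed.

Lemma not_tame : ~ (forall u : red_atom H, (tame_degree R u < +oo)%E).
Proof.
have [w wP] := two_atom_elements => /(_ w)/sup_inf_nat_bounded[N hN].
(* The value [N + 3] exceeds the length 2 of the short factorization plus the supposed bound [N]. *)
have [a [u1 [u2 [z [az1 az2 nw aP]]]]] := wP N.+3.
have [n tn nN] := hN a.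
have [|y [az' [c yE]] d] := tn _ _ az1.
  by exists ([mset w] + z); split=> //; exists z.
have {}yE : y = [mset w] + c := yE.
rewrite yE in az' d; have := with_atom_long nw aP az'.
have := fm_dist_ge ([mset u1] + [mset u2]) ([mset w] + c).
by rewrite size_pair; lia.
Qed.

Lemma Delta_infinite : ~ finite_set (Delta H).
Proof.
move=> /finite_nat_bounded[N DN]; have [a [l [a2 al Nl aP]]] := two_lengths N.+3.
have [|n [/DN nN n0 an _]] := Delta_next a2 al; first by lia.
by case: (aP _ an); lia.
Qed.

Lemma Delta_nonempty : Delta H <> set0.
Proof. by move=> D0; apply: Delta_infinite; rewrite D0; exact: finite_set0. Qed.

Lemma elasticity_irrational q : elasticity R H <> (ratr q)%:E.
Proof.
move=> e; have [l Vl] := V2_unbounded (2 * (Num.trunc (ratr q : R)).+1)%N.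
have := elasticity_ge Vl isT; rewrite e lee_fin ler_pdivrMr // => h1 h2.
have := truncnS_gt (ratr q : R); rewrite ltNge => /negP; apply.
rewrite -(ler_pM2r (_ : (0 : R) < 2)) //; apply: le_trans h1.
by rewrite -natrM ler_nat mulnC.
Qed.

Lemma rho2_infinite : rho_ R H 2 = +oo%E.
Proof.
apply/eqP; rewrite -leye_eq leNgt; apply/negP => /ereal_lt_nat[N].
apply/negP; rewrite -leNgt; have [l Vl Nl] := V2_unbounded N.
by apply: le_trans (sup_nat_ge R Vl); rewrite lee_fin ler_nat.
Qed.

Lemma rho1 : rho_ R H 1 = 1%E.
Proof. by apply: (@sup_nat_max _ _ 1%N) => [|l /V1->//]; exact: V_refl LsetD Lset00 Lset1 1. Qed.

(** An almost arithmetical progression is bounded above, because its central part has a maximum. *)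
Lemma V2_not_AAP d M : ~ is_AAP d M [set n%:Z%R | n in V_ H 2].
Proof.
move=> [_ [y [m [L1 [L0 [L2 [E _ _ [_ [_ L0m] _ L1P L2P]]]]]]]].
have [l Vl] := V2_unbounded (`|y| + `|m| + M).+1.
have : [set n%:Z | n in V_ H 2] l%:Z by exists l.
by rewrite E => -[x [[/L1P|/L0m]|/L2P] h e]; move: h e => /=; lia.
Qed.

End Unbounded.
End Invariants.

(** * Assembling the equivalences *)

Definition bounded_arithmetic (P A : choiceType) (ct : A -> {mset P}) : Prop :=
  [/\ forall u, exists N, forall y z, msum ct z = ct u + y ->
        exists z', msum ct ([mset u] + z') = ct u + y /\
          (fm_dist z ([mset u] + z')%R <= N)%N,
      exists N, forall z z', msum ct z = msum ct z' -> chain ct N z z' &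
      rational_growth ct].

Lemma bounded_arithmetic_of_lower_bound (P A : choiceType) (s : P -> int)
    (ct : A -> {mset P}) (m : nat) (u0 : A) :
  atom_param s ct -> (forall p, - m%:Z <= s p) ->
  (forall p, 0 < s p -> exists q, s q < 0) -> bounded_arithmetic ct.
Proof.
move=> Hct s_ge0 s_neg; pose m' := m.+1.
have s_ge p : - m'%:Z <= s p by have := s_ge0 p; rewrite /m'; lia.
split.
- move=> u; exists (m' * size (ct u)).+1 => y z; exact: tame_exchange Hct _ s_ge isT u y z.
- exists (m' * m'.*2.+1)%N => z z'; exact: chain_bounded Hct _ s_ge isT z z'.
(* The choice of representatives depends on whether the classes are also bounded above; in the
   unbounded case [s_neg] supplies the negative prime used for absorption. *)
have [[M s_le]|unb] := pselect (exists M : nat, forall p, s p <= M%:Z).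
  apply: (@rational_growth_finite _ _ s ct Hct (maxn m' M) _ _ u0) => [p||p].
  - by have := s_ge p; lia.
  - by rewrite leq_max.
  - by have := s_le p; lia.
have {}unb n : exists p, n%:Z <= s p.
  apply: contrapT => no; apply: unb; exists n => p.
  by rewrite leNgt; apply/negP => lt_n; apply: no; exists p; exact: ltW.
have [p1 sp1] := unb 1%N; have [|q0 sq0] := s_neg p1; first by lia.
exact: (rational_growth_infinite Hct s_ge isT u0 sq0 unb).
Qed.

Lemma finite_pos_range (P : choiceType) (s : P -> int) :
  finite_set ([set s p | p in [set: P]] `&` [set g | 0 < g])%classic ->
  exists m : nat, forall p, s p <= m%:Z.
Proof.
move=> /(finite_image absz)/finite_nat_bounded[m hm]; exists m => p.
have [le0|lt0] := leP (s p) 0; first by lia.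
have := hm `|s p|%N; rewrite (_ : (_ <= _)%N = (s p <= m%:Z)); last by lia.
by apply; exists (s p) => //; split=> //; exists p.
Qed.

Lemma infinite_pos_range (P : choiceType) (s : P -> int) :
  ~ finite_set ([set s p | p in [set: P]] `&` [set g | 0 < g])%classic ->
  forall n : nat, exists p, n%:Z <= s p.
Proof.
move=> inf n; apply: contrapT => no; apply: inf.
apply: (@sub_finite_set _ _ [set k%:Z | k in `I_n]); last exact/finite_image/finite_II.
move=> _ [[p _ <-] /= sp]; exists `|s p|%N; last by lia.
rewrite /= ltnNge; apply/negP => le_n; apply: no; exists p; lia.
Qed.

Local Open Scope mset_scope.
Local Open Scope classical_set_scope.
Local Open Scope ring_scope.
Local Open Scope ereal_scope.

Theorem theorem4p2 (R : realType) (H : cmonoidType) (P : choiceType)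
    (phi : {additive H -> {mset P}}) (psi : {additive class_group phi -> int}) :
  is_krull H -> divisor_hom phi -> cofinal_hom phi -> bijective psi ->
  let G_P : set int := psi @` prime_classes phi in
  [<-> finite_set (G_P `&` [set g | (0 < g)%R]) \/
         finite_set (G_P `&` [set g | (g < 0)%R]);
       forall u : red_atom H, tame_degree R u < +oo;
       catenary_degree R H < +oo;
       finite_set (Delta H);
       exists q : rat, elasticity R H = (ratr q)%:E;
       rho_ R H 2 < +oo;
       exists M : nat, (0 < M)%N /\
         forall k, (0 < k)%N -> rho_ R H k.+1 - rho_ R H k <= M%:R%:E;
       Delta H = set0 \/
         exists M : nat, (0 < M)%N /\
           forall k, (0 < k)%N ->
             is_AAP (min_nat (Delta H)) M [set n%:Z%R | n in V_ H k]].
Proof.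
move=> _ phi_div phi_cof psi_bij G_P.
have [u0] := red_atom_exists phi_div phi_cof psi_bij.
have Hct := atom_content_param phi_div psi_bij.
have ZsetE := Zset_content phi_div.
have phi_onto := class_val_eq0 phi_div psi_bij.
have phi_sum0 := class_val_phi psi.
set s := class_val psi in Hct phi_onto phi_sum0.
set ct := atom_content phi in Hct ZsetE.
have G_PE : G_P = [set s p | p in [set: P]].
  apply/seteqP; split=> [_ [_ [p _ <-] <-]|_ [p _ <-]]; first by exists p.
  by exists (divisor_class phi [mset p]) => //; exists p.
have negE : finite_set (G_P `&` [set g | (g < 0)%R]) <->
    finite_set ([set (- s p)%R | p in [set: P]] `&` [set g | (0 < g)%R]).
  split=> fin; [apply: (sub_finite_set _ (finite_image -%R fin))|
    apply: (sub_finite_set _ (finite_image -%R fin))].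
    move=> _ [[p _ <-] /=]; rewrite oppr_gt0 => sp; exists (s p) => //; split=> //.
    by rewrite G_PE; exists p.
  rewrite G_PE => _ [[p _ <-] /= sp]; exists (- s p)%R; last exact: opprK.
  by split; [exists p | rewrite /= oppr_gt0].
set P0 := _ \/ _.
have bounded : P0 -> bounded_arithmetic ct.
  case=> [|/negE] fin.
    have [m sm] : exists m : nat, forall p, (s p <= m%:Z)%R.
      by apply: finite_pos_range; rewrite -G_PE.
    (* The conclusion does not mention the classes, so a bound from above is handled by changing
       their sign. *)
    apply: (bounded_arithmetic_of_lower_bound (m := m) u0 (atom_param_opp Hct)) => p.
      by rewrite lerN2.
    rewrite oppr_gt0 => /(prime_class_neg phi_cof)[q sq]; exists q.
    by rewrite oppr_lt0.
  have [m sm] := finite_pos_range fin.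
  apply: (bounded_arithmetic_of_lower_bound (m := m) u0 Hct) => p.
    by rewrite lerNl.
  exact: prime_class_pos phi_cof p.
(* A property that fails for classes unbounded in both directions implies [P0], by
   contraposition. *)
have unbounded (Q : Prop) : ((forall n : nat, exists p, (n%:Z <= s p)%R) ->
    (forall n : nat, exists p, (s p <= - n%:Z)%R) -> ~ Q) -> Q -> P0.
  move=> nQ hQ; apply: contrapT => /not_orP[inf_pos inf_neg]; apply: nQ hQ.
    by apply: infinite_pos_range; rewrite -G_PE.
  move=> n; have [|p sp] := @infinite_pos_range _ (fun p => - s p)%R _ n.
    by move/negE.
  by exists p; rewrite lerNr.
(* In the cycle of implications (c) yields (d) directly; every later condition, and also (b), is
   first led back to [P0]. *)
tfae.
- by move=> /bounded[tame _ _] u; apply: (tame_degree_finite R ZsetE); exact: tame.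
- move=> h; suff /bounded[_ cat _] : P0 by exact: (catenary_degree_finite R ZsetE).
  by apply: unbounded h => up un; apply: (not_tame Hct ZsetE phi_onto).
- move=> /catenary_degree_Delta[N DN].
  by apply: (@sub_finite_set _ _ `I_(N.+1)) => [n /DN //|]; exact: finite_II.
- move=> h; suff /bounded[_ _ rg] : P0 by apply: (elasticity_rational R u0 Hct ZsetE).
  by apply: unbounded h => up un; apply: (Delta_infinite Hct ZsetE phi_onto).
- move=> h; suff /bounded[_ _ rg] : P0 by apply: (rho2_finite R u0 Hct ZsetE).
  apply: unbounded h => up un [q]; exact: (elasticity_irrational Hct ZsetE phi_onto).
- move=> h; suff /bounded[_ _ rg] : P0 by apply: (rho_increments R u0 Hct ZsetE).
  apply: unbounded h => up un; rewrite (rho2_infinite R Hct ZsetE phi_onto up un).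
  by rewrite ltxx.
- move=> h; suff /bounded[_ cat rg] : P0.
    have [N DN] := catenary_degree_Delta (catenary_degree_finite R ZsetE cat).
    exact: (V_AAP_all u0 Hct ZsetE phi_onto rg DN).
  (* The first increment is already infinite, since [rho_1] is 1 and [rho_2] is infinite. *)
  apply: unbounded h => up un [M [_ /(_ 1%N isT)]].
  by rewrite (rho2_infinite R Hct ZsetE phi_onto up un) (rho1 R u0 Hct ZsetE phi_onto).
- move=> h; apply: unbounded h => up un [|[M [_ /(_ 2%N isT)]]].
    exact: (Delta_nonempty Hct ZsetE phi_onto).
  exact: (V2_not_AAP Hct ZsetE phi_onto).
Qed.
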